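(* Let $A \subseteq \omega$, and let $\mathbb{P} = (P,\leq,V)$ be a notion of forcing such that the product notion $\mathbb{C} \times \mathbb{P}$ is $1$-decidable in $A$. Then there exist an $A$-computable perfect tree $T \subseteq 2^{<\omega}$ and an $A$-computable class $\mathcal{C}$ of dense subsets of $P$ such that for all $S \in [T]$ and all $G \subseteq \omega$, if $G$ is $\mathcal{C}$-generic for $\mathbb{P}$ then $S \oplus G \not\geq_T A$.
   Context: A notion of forcing is a triple $\mathbb{P} = (P,\leq,V)$ where $P$ is an infinite subset of $\omega$, $\leq$ is a partial order on $P$, and $V : P \to 2^{<\omega}$ (the valuation) is monotone from $(P,\leq)$ to $(2^{<\omega},\succeq)$ (i.e., $q \leq p$ implies $V(q) \succeq V(p)$), such that for each $n$ the set $\{p \in P : |V(p)| \geq n\}$ is dense in $(P,\leq)$. $\mathbb{P}$ is $A$-computable if $P$, $\leq$ and $V$ are $A$-computable. A set $D \subseteq P$ is dense if every $p \in P$ has some $q \leq p$ in $D$. An $A$-computable class of subsets of $P$ means a sequence $\{D_e\}_{e\in\omega}$ of subsets of $P$ that is uniformly $A$-computable. For a filter $F$ on $(P,\leq)$ (nonempty, upward closed, any two members have a common extension in $F$), $|V(F)| = \sup_{p \in F}|V(p)|$, and $V(F)$ denotes the union of the compatible strings $V(p)$, $p \in F$. For a set $\mathcal{C}$ of subsets of $P$, a filter $F$ is $\mathcal{C}$-generic for $\mathbb{P}$ if $|V(F)| = \infty$ and for every $C \in \mathcal{C}$, either $F \cap C \neq \emptyset$ or $F$ contains some $p$ such that no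 $q \leq p$ lies in $C$; a set $G \subseteq \omega$ is $\mathcal{C}$-generic for $\mathbb{P}$ if $G = V(F)$ for some $\mathcal{C}$-generic filter $F$. Forcing language: the language of arithmetic augmented by a set constant $\dot G$. The forcing relation $p \Vdash_{\mathbb{P}} \varphi$ is defined recursively: for atomic $\varphi$, $p \Vdash \varphi$ if $\varphi$ is a true atomic sentence of arithmetic, or $\varphi$ is $\dot n \in \dot G$ with $n < |V(p)|$ and $V(p)(n)=1$, or $\varphi$ is $\dot n \notin \dot G$ with $n < |V(p)|$ and $V(p)(n) = 0$; $p \Vdash \varphi \wedge \psi$ iff $p \Vdash \varphi$ and $p \Vdash \psi$; $p \Vdash \exists x\,\varphi(x)$ iff $p \Vdash \varphi(\dot n)$ for some $n$; $p \Vdash \neg\varphi$ iff no $q \leq p$ forces $\varphi$. $\mathbb{P}$ is $1$-decidable in $A$ if $\mathbb{P}$ is $A$-computable and, for a fixed effective enumeration $\{\varphi_i\}$ of the $\Sigma^0_1$ sentences of the forcing language, there is an $A$-computable $f : P \times \omega \to P \times \{0,1\}$ such that whenever $f(p,i) = (q,t)$ we have $q \leq p$, and $q \Vdash \varphi_i$ if $t = 1$, while $q \Vdash \neg\varphi_i$ if $t = 0$. $\mathbb{C}$ is Cohen forcing (binary strings ordered by extension, valuation the identity). The product $\mathbb{C} \times \mathbb{P}$ has as conditions the pairs $(\sigma,p) \in 2^{<\omega} \times P$ with $|\sigma| = |V(p)|$ (coded as natural numbers), ordered componentwise ($(\sigma',p') \leq (\sigma,p)$ iff $\sigma' \succeq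 \sigma$ and $p' \leq p$), with valuation $V_\times(\sigma,p) = \sigma \oplus V(p)$ (the interleaving of the two strings). A tree $T\subseteq 2^{<\omega}$ is perfect if every node has two incomparable extensions in $T$; $[T]$ is its set of infinite paths; $S \oplus G = \{2n : n\in S\}\cup\{2n+1 : n \in G\}$. *)

(* Defs.v *)
From HB Require Import structures.
From mathcomp Require Import all_boot.
From mathcomp Require Import boolp classical_sets cardinality.
From mathcomp Require Import zify.
From Stdlib Require Cantor.

Set Implicit Arguments.
Unset Strict Implicit.
Unset Printing Implicit Defensive.

Local Open Scope classical_set_scope.

(* Subsets of omega are [set nat], finite binary strings are [seq bool], read
   from left to right. *)

Definition npair (x y : nat) : nat := Cantor.to_nat (x, y).
Definition nfst (n : nat) : nat := (Cantor.of_nat n).1.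
Definition nsnd (n : nat) : nat := (Cantor.of_nat n).2.

Lemma nfst_pair x y : nfst (npair x y) = x.
Proof. by rewrite /nfst Cantor.cancel_of_to. Qed.

Lemma nsnd_pair x y : nsnd (npair x y) = y.
Proof. by rewrite /nsnd Cantor.cancel_of_to. Qed.

Lemma npairK n : npair (nfst n) (nsnd n) = n.
Proof.
rewrite /npair /nfst /nsnd -[RHS]Cantor.cancel_to_of.
by case: (Cantor.of_nat n).
Qed.

(* Bijective coding of strings: the empty string is 0, and b :: s is
   2 * code s + 1 + b. *)
Fixpoint str_code (s : seq bool) : nat :=
  if s is b :: s' then (str_code s').*2 + b.+1 else 0.

Fixpoint str_dec_rec (k n : nat) : seq bool :=
  match k, n with
  | k'.+1, m.+1 => odd m :: str_dec_rec k' m./2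
  | _, _ => [::]
  end.

Definition str_dec (n : nat) : seq bool := str_dec_rec n n.

Lemma str_codeK : cancel str_code str_dec.
Proof.
suff H s k : str_code s <= k -> str_dec_rec k (str_code s) = s.
  by move=> s; exact: H.
elim: s k => [|b s IH] [|k] /=; rewrite ?addnS //= => lek.
by rewrite oddD odd_double oddb addnC half_bit_double IH //; move: lek; lia.
Qed.

Lemma str_decK : cancel str_dec str_code.
Proof.
suff H k n : n <= k -> str_code (str_dec_rec k n) = n.
  by move=> n; exact: H.
elim: k n => [|k IH] [|n] //=; rewrite ltnS => lek.
rewrite IH; last by lia.
by rewrite addnS addnC odd_double_half.
Qed.

(* Relativized mu-recursive functions. Functions of several arguments are
   coded as unary functions by pairing. *)
Inductive oracle_code : Type :=
| CZero
| CSucc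
| CFst
| CSnd
| COracle
| CPair of oracle_code & oracle_code
| CComp of oracle_code & oracle_code
| CRec of oracle_code & oracle_code
| CMu of oracle_code.

(* [eval A c x y] : the partial A-recursive function with code c is defined at
   x, with value y. *)
Fixpoint eval (A : set nat) (c : oracle_code) (x y : nat) : Prop :=
  match c with
  | CZero => y = 0
  | CSucc => y = x.+1
  | CFst => y = nfst x
  | CSnd => y = nsnd x
  | COracle => y = `[< A x >]
  | CPair f g =>
      exists a b, [/\ eval A f x a, eval A g x b & y = npair a b]
  | CComp f g => exists2 z, eval A g x z & eval A f z y
  | CRec f g =>
      (* h(a,0) = f(a), h(a,n+1) = g(a,(n,h(a,n))) *)
      (fix rec (n v : nat) : Prop :=
         match n with
         | 0 => eval A f (nfst x) v
         | m.+1 => exists2 z, rec m z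
                     & eval A g (npair (nfst x) (npair m z)) v
         end) (nsnd x) y
  | CMu f =>
      eval A f (npair x y) 0 /\
      forall z, z < y -> exists v, eval A f (npair x z) v.+1
  end.

Lemma eval_inj A c x y z : eval A c x y -> eval A c x z -> y = z.
Proof.
elim: c x y z => [|||||f IHf g IHg|f IHf g IHg|f IHf g IHg|f IH] x y z /=;
  try by move=> -> ->.
- by move=> [a [b [fa gb ->]]] [a' [b' [/IHf-/(_ _ fa)<- /IHg-/(_ _ gb)<- ->]]].
- by move=> [a /IHg ga fy] [b /ga <-]; exact: IHf.
- elim: (nsnd x) y z => [|n IHn] y z; first exact: IHf.
  by move=> [a /IHn ha gy] [b /ha <-]; exact: IHg.
- move=> [fy ly] [fz lz]; case: (ltngtP y z) => // [/lz|/ly] [v].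
    by move/IH => /(_ _ fy).
  by move/IH => /(_ _ fz).
Qed.

Definition computable_on (A D : set nat) (f : nat -> nat) : Prop :=
  exists c, forall x, D x -> eval A c x (f x).

Definition computable_set (A B : set nat) : Prop :=
  computable_on A setT (fun x => `[< B x >]).

Definition turing_le (B A : set nat) : Prop := computable_set A B.

(* A notion of forcing lives on a subset of nat; [ext q p] means that q extends
   p, and the values of [valuation] outside of [cond] are irrelevant. *)
Record forcing := Forcing {
  cond : set nat;
  ext : nat -> nat -> Prop;
  valuation : nat -> seq bool
}.

Definition dense_in (P : forcing) (D : set nat) : Prop :=
  D `<=` cond P /\ forall p, cond P p -> exists2 q, ext P q p & D q.

Record notion_of_forcing (P : forcing) : Prop := NotionOfForcing {
  cond_infinite : infinite_set (cond P);
  ext_cond : forall q p, ext P q p -> cond P q /\ cond P p;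
  ext_refl : forall p, cond P p -> ext P p p;
  ext_trans : forall p q r, ext P r q -> ext P q p -> ext P r p;
  ext_anti : forall p q, ext P p q -> ext P q p -> p = q;
  val_mono : forall q p, ext P q p -> prefix (valuation P p) (valuation P q);
  val_dense : forall n,
    dense_in P [set p | cond P p /\ n <= size (valuation P p)]
}.

Definition computable_forcing (A : set nat) (P : forcing) : Prop :=
  [/\ computable_set A (cond P),
      computable_set A [set n | ext P (nfst n) (nsnd n)]
    & computable_on A (cond P) (fun p => str_code (valuation P p))].

Definition computable_class (A : set nat) (D : nat -> set nat) : Prop :=
  computable_set A [set n | D (nfst n) (nsnd n)].

Record is_filter (P : forcing) (F : set nat) : Prop := IsFilter {
  filter_cond : F `<=` cond P;
  filter_neq0 : F !=set0;
  filter_up : forall q p, F q -> ext P q p -> F p;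
  filter_dir : forall p q, F p -> F q ->
    exists r, [/\ F r, ext P r p & ext P r q]
}.

Definition val_infinite (P : forcing) (F : set nat) : Prop :=
  forall n, exists2 p, F p & n <= size (valuation P p).

Definition val_filter (P : forcing) (F : set nat) : set nat :=
  [set n | exists2 p, F p & onth (valuation P p) n = Some true].

Definition generic_filter (P : forcing) (C : set (set nat)) (F : set nat)
    : Prop :=
  [/\ is_filter P F, val_infinite P F
    & forall D, C D ->
        F `&` D !=set0 \/ exists2 p, F p & forall q, ext P q p -> ~ D q].

Definition generic (P : forcing) (C : set (set nat)) (G : set nat) : Prop :=
  exists2 F, generic_filter P C F & G = val_filter P F.

(* The forcing language, with de Bruijn indices. *)
Inductive term : Type :=
| TVar of nat
| TZero
| TSucc of term
| TAdd of term & term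
| TMul of term & term.

Inductive form : Type :=
| FEq of term & term
| FLt of term & term
| FIn of term
| FNotin of term
| FAnd of form & form
| FNot of form
| FEx of form.

Definition scons (n : nat) (rho : nat -> nat) : nat -> nat :=
  fun k => if k is k'.+1 then rho k' else n.

Fixpoint teval (rho : nat -> nat) (t : term) : nat :=
  match t with
  | TVar k => rho k
  | TZero => 0
  | TSucc t => (teval rho t).+1
  | TAdd t u => teval rho t + teval rho u
  | TMul t u => teval rho t * teval rho u
  end.

(* The environment rho stands for the simultaneous substitution of the numeral of rho k for
   the k-th free variable. *)
Fixpoint forces_env (P : forcing) (p : nat) (rho : nat -> nat) (a : form)
    : Prop :=
  match a with
  | FEq t u => teval rho t = teval rho u
  | FLt t u => teval rho t < teval rho u
  | FIn t => onth (valuation P p) (teval rho t) = Some true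
  | FNotin t => onth (valuation P p) (teval rho t) = Some false
  | FAnd a b => forces_env P p rho a /\ forces_env P p rho b
  | FNot a => forall q, ext P q p -> ~ forces_env P q rho a
  | FEx a => exists n, forces_env P p (scons n rho) a
  end.

Definition forces (P : forcing) (p : nat) (a : form) : Prop :=
  forces_env P p (fun=> 0) a.

(* [tvars b t]: all variables of t satisfy b. *)
Fixpoint tvars (b : pred nat) (t : term) : bool :=
  match t with
  | TVar k => b k
  | TZero => true
  | TSucc t => tvars b t
  | TAdd t u | TMul t u => tvars b t && tvars b u
  end.

(* The free variables of the formula are less than n. *)
Fixpoint fclosed (n : nat) (a : form) : bool :=
  match a with
  | FEq t u | FLt t u => tvars (ltn^~ n) t && tvars (ltn^~ n) u
  | FIn t | FNotin t => tvars (ltn^~ n) t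
  | FAnd a b => fclosed n a && fclosed n b
  | FNot a => fclosed n a
  | FEx a => fclosed n.+1 a
  end.

(* Bounded formulas: quantifiers occur only as  exists x, x < t /\ a  with x
   not in t; the bounded universal quantifier is  ~ exists x, x < t /\ ~ a. *)
Fixpoint bounded (a : form) : bool :=
  match a with
  | FEq _ _ | FLt _ _ | FIn _ | FNotin _ => true
  | FAnd a b => bounded a && bounded b
  | FNot a => bounded a
  | FEx (FAnd (FLt (TVar 0) t) a) => tvars (leq 1) t && bounded a
  | FEx _ => false
  end.

Fixpoint sigma1 (a : form) : bool :=
  bounded a || (if a is FEx b then sigma1 b else false).

Definition sigma1_sentence (a : form) : bool := fclosed 0 a && sigma1 a.

Fixpoint term_code (t : term) : nat :=
  match t with
  | TVar k => npair 0 k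
  | TZero => npair 1 0
  | TSucc t => npair 2 (term_code t)
  | TAdd t u => npair 3 (npair (term_code t) (term_code u))
  | TMul t u => npair 4 (npair (term_code t) (term_code u))
  end.

Fixpoint term_dec_rec (k n : nat) : term :=
  if k isn't k'.+1 then TZero else
  let m := nsnd n in
  match nfst n with
  | 0 => TVar m
  | 1 => TZero
  | 2 => TSucc (term_dec_rec k' m)
  | 3 => TAdd (term_dec_rec k' (nfst m)) (term_dec_rec k' (nsnd m))
  | _ => TMul (term_dec_rec k' (nfst m)) (term_dec_rec k' (nsnd m))
  end.

Definition term_dec (n : nat) : term := term_dec_rec n.+1 n.

Fixpoint form_code (a : form) : nat :=
  match a with
  | FEq t u => npair 0 (npair (term_code t) (term_code u))
  | FLt t u => npair 1 (npair (term_code t) (term_code u))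
  | FIn t => npair 2 (term_code t)
  | FNotin t => npair 3 (term_code t)
  | FAnd a b => npair 4 (npair (form_code a) (form_code b))
  | FNot a => npair 5 (form_code a)
  | FEx a => npair 6 (form_code a)
  end.

Fixpoint form_dec_rec (k n : nat) : form :=
  if k isn't k'.+1 then FEq TZero TZero else
  let m := nsnd n in
  match nfst n with
  | 0 => FEq (term_dec (nfst m)) (term_dec (nsnd m))
  | 1 => FLt (term_dec (nfst m)) (term_dec (nsnd m))
  | 2 => FIn (term_dec m)
  | 3 => FNotin (term_dec m)
  | 4 => FAnd (form_dec_rec k' (nfst m)) (form_dec_rec k' (nsnd m))
  | 5 => FNot (form_dec_rec k' m)
  | _ => FEx (form_dec_rec k' m)
  end.

Definition form_dec (n : nat) : form := form_dec_rec n.+1 n.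

Lemma npair_ge x y : x + y <= npair x y.
Proof. by have /leP := Cantor.to_nat_non_decreasing x y; rewrite plusE addnC. Qed.

Lemma npair_gt x y : 0 < x -> y < npair x y.
Proof. by have := npair_ge x y; lia. Qed.

Lemma term_codeK : cancel term_code term_dec.
Proof.
suff H t k : term_code t < k -> term_dec_rec k (term_code t) = t.
  by move=> t; exact: H.
elim: t k => [k||t IH|t IHt u IHu|t IHt u IHu] [|m] //=;
  rewrite ?nfst_pair ?nsnd_pair //= ?ltnS => lem.
- by rewrite IH //; apply: leq_trans lem; exact: npair_gt.
- rewrite ?nfst_pair ?nsnd_pair.
  have H := leq_trans (npair_gt _ (isT : 0 < 3)) lem.
  have H2 := npair_ge (term_code t) (term_code u).
  by rewrite IHt ?IHu //; lia.
- rewrite ?nfst_pair ?nsnd_pair.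
  have H := leq_trans (npair_gt _ (isT : 0 < 4)) lem.
  have H2 := npair_ge (term_code t) (term_code u).
  by rewrite IHt ?IHu //; lia.
Qed.

Lemma form_codeK : cancel form_code form_dec.
Proof.
suff H a k : form_code a < k -> form_dec_rec k (form_code a) = a.
  by move=> a; exact: H.
elim: a k => [t u|t u|t|t|a IHa b IHb|a IH|a IH] [|m] //=;
  rewrite ?nfst_pair ?nsnd_pair //= ?nfst_pair ?nsnd_pair ?term_codeK //
    ?ltnS => lem.
- have H := leq_trans (npair_gt _ (isT : 0 < 4)) lem.
  have H2 := npair_ge (form_code a) (form_code b).
  by rewrite IHa ?IHb //; lia.
- by rewrite IH //; apply: leq_trans lem; exact: npair_gt.
- by rewrite IH //; apply: leq_trans lem; exact: npair_gt.
Qed.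

(* Effective enumeration of the Sigma^0_1 sentences: numbers which do not
   decode to such a sentence are sent to 0 = 0. *)
Definition sigma1_enum (i : nat) : form :=
  if sigma1_sentence (form_dec i) then form_dec i else FEq TZero TZero.

Lemma sigma1_enum_sentence i : sigma1_sentence (sigma1_enum i).
Proof. by rewrite /sigma1_enum; case: ifP. Qed.

Lemma sigma1_enumE a : sigma1_sentence a -> sigma1_enum (form_code a) = a.
Proof. by rewrite /sigma1_enum form_codeK => ->. Qed.

Definition one_decidable (A : set nat) (P : forcing) : Prop :=
  computable_forcing A P /\
  exists f : nat -> nat -> nat * bool,
    (exists c, forall p i, cond P p ->
       eval A c (npair p i) (npair (f p i).1 (f p i).2)) /\
    (forall p i, cond P p ->
       ext P (f p i).1 p /\
       if (f p i).2 then forces P (f p i).1 (sigma1_enum i)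
       else forces P (f p i).1 (FNot (sigma1_enum i))).

Fixpoint interleave (s t : seq bool) : seq bool :=
  match s, t with
  | a :: s', b :: t' => [:: a, b & interleave s' t']
  | _, _ => [::]
  end.

Definition cohen : forcing :=
  Forcing setT (fun m n => prefix (str_dec n) (str_dec m)) str_dec.

(* Product restricted to the pairs of conditions with valuations of equal
   length. *)
Definition forcing_prod (Q P : forcing) : forcing :=
  let C := [set n | [/\ cond Q (nfst n), cond P (nsnd n)
                      & size (valuation Q (nfst n)) = size (valuation P (nsnd n))]] in
  Forcing C
    (fun m n => [/\ C m, C n, ext Q (nfst m) (nfst n) & ext P (nsnd m) (nsnd n)])
    (fun n => interleave (valuation Q (nfst n)) (valuation P (nsnd n))).

Lemma size_interleave s t :
  size s = size t -> size (interleave s t) = (size t).*2.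
Proof. by elim: s t => [|a s IH] [|b t] //= [/IH->]. Qed.

Lemma prefix_interleave s t s' t' : size s = size t ->
  prefix s s' -> prefix t t' -> prefix (interleave s t) (interleave s' t').
Proof.
elim: s t s' t' => [|a s IH] [|b t] [|a' s'] [|b' t'] //= [st].
by move=> /andP[-> ss] /andP[-> tt] /=; exact: IH.
Qed.

Lemma cohen_prod_notion P :
  notion_of_forcing P -> notion_of_forcing (forcing_prod cohen P).
Proof.
move=> [Pinf Pc Pr Pt Pa Pm Pd]; split => /=.
- move=> fin; apply: Pinf; apply: sub_finite_set (finite_image nsnd fin).
  move=> p Pp /=; exists (npair (str_code (valuation P p)) p).
    by rewrite nfst_pair nsnd_pair str_codeK.
  by rewrite nsnd_pair.
- by move=> q p [].
- by move=> p [Cp Pp Ep]; split => //; [exact: prefix_refl|exact: Pr].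
- move=> p q r [? ? rq1 rq2] [? ? qp1 qp2]; split => //.
    exact: prefix_trans qp1 rq1.
  exact: Pt rq2 qp2.
- move=> p q [_ _ pq1 pq2] [_ _ qp1 qp2].
  rewrite -(npairK p) -(npairK q) (Pa _ _ pq2 qp2); congr npair.
  apply: (can_inj str_decK); apply/eqP.
  have /eqP sz : size (str_dec (nfst q)) == size (str_dec (nfst p)).
    by rewrite eqn_leq !size_prefix.
  by move: pq1; rewrite prefixE sz take_size.
- move=> q p [Cq [_ _ Ep] qp1 qp2]; apply: prefix_interleave => //.
  exact: Pm.
- move=> n; split=> [m [] //|m [_ Pp Ep]].
  have [q qp [Pq nq]] := (Pd n).2 _ Pp.
  have lpq := size_prefix (Pm _ _ qp).
  pose s := str_dec (nfst m) ++
    nseq (size (valuation P q) - size (valuation P (nsnd m))) false.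
  have Es : size s = size (valuation P q).
    by rewrite size_cat size_nseq Ep subnKC.
  exists (npair (str_code s) q); rewrite /= !nfst_pair !nsnd_pair !str_codeK.
    by split => //; exact: prefix_prefix.
  by split => //; rewrite size_interleave // -addnn; lia.
Qed.

Record perfect_tree (T : set (seq bool)) : Prop := PerfectTree {
  tree_root : T [::];
  tree_prefix : forall s t, prefix s t -> T t -> T s;
  tree_perfect : forall s, T s ->
    exists t u, [/\ T t, T u, prefix s t, prefix s u
                  & ~~ prefix t u && ~~ prefix u t]
}.

Definition computable_tree (A : set nat) (T : set (seq bool)) : Prop :=
  computable_set A [set n | T (str_dec n)].

Definition paths (T : set (seq bool)) : set (set nat) :=
  [set S | forall n, T (mkseq (fun i => `[< S i >]) n)].

Definition set_join (S G : set nat) : set nat :=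
  [set m | if odd m then G m./2 else S m./2].

(* Main.v *)
Require Import Defs.
From mathcomp Require Import all_boot.
From mathcomp Require Import boolp classical_sets.
From mathcomp Require Import zify.

(* The requirements are indexed by pairs of codes of bounded formulas B0, B1:
   if A is computable from X, then the graph of A is Sigma^0_1 in X, so
   A(x) = b iff X satisfies "exists w, B_b(x, w)" for suitable B0, B1. A
   condition beats (B0, B1) once it extends some answer of the decision
   function f of C x P that contradicts these equivalences at some x.

   Every condition has an extension beating (B0, B1). Otherwise, B0 and B1
   define A correctly in every Y built from a filter below the condition that
   meets all the answers of f, so f, being A-computable, is uniformly
   Sigma^0_1 over all such Y; the diagonal sentence "f answers 0 to this very
   sentence" then contradicts the correctness of f.

   The tree consists of the strings that agree with a limit string except at
   the free positions |g_0| < |g_1| < ... At stage s = (e, c) one extends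
   g_s by one free position and a block, and the P-part of c to some q_s of the
   same length, so that (a, q_s) beats e for all strings a of that length ending
   with this block. The dense sets are D_e = {q_s : s = (e, c)}. Since P itself
   might only be A-c.e., its elements are accessed through product conditions
   c, and q_s > s makes D_e A-computable. *)

Set Implicit Arguments.
Unset Strict Implicit.
Unset Printing Implicit Defensive.

Local Open Scope classical_set_scope.

(** * Forcing and truth *)

Fixpoint sat (Y : set nat) (rho : nat -> nat) (a : form) : Prop :=
  match a with
  | FEq t u => teval rho t = teval rho u
  | FLt t u => teval rho t < teval rho u
  | FIn t => Y (teval rho t)
  | FNotin t => ~ Y (teval rho t)
  | FAnd a b => sat Y rho a /\ sat Y rho b
  | FNot a => ~ sat Y rho a
  | FEx a => exists n, sat Y (scons n rho) a
  end.

(** Induction on [form] yields a hypothesis for the conjunction below [FEx], while a bounded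
    quantifier calls for one on the second conjunct [a]; hence the explicit [fix]. *)
Lemma bounded_ind (Q : form -> Prop) :
  (forall t u, Q (FEq t u)) -> (forall t u, Q (FLt t u)) ->
  (forall t, Q (FIn t)) -> (forall t, Q (FNotin t)) ->
  (forall a b, Q a -> Q b -> Q (FAnd a b)) ->
  (forall a, Q a -> Q (FNot a)) ->
  (forall t a, tvars (leq 1) t -> Q a -> Q (FEx (FAnd (FLt (TVar 0) t) a))) ->
  forall a, bounded a -> Q a.
Proof.
move=> Qeq Qlt Qin Qnotin Qand Qnot Qex; fix IH 1.
case=> [t u|t u|t|t|a b|a|a] //=; do ?by move=> _.
- by move=> /andP[? ?]; apply: Qand; exact: IH.
- by move=> ?; apply: Qnot; exact: IH.
case: a => // -[] // [] // [] // t a /andP[? ?].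
by apply: Qex => //; exact: IH.
Qed.

Lemma eq_teval rho rho' t b :
  tvars b t -> (forall k, b k -> rho k = rho' k) -> teval rho t = teval rho' t.
Proof.
move=> + H; elim: t => //= [t IH tb|t IHt u IHu|t IHt u IHu]; first by rewrite IH.
  all: by move=> /andP[/IHt-> /IHu->].
Qed.

Lemma teval_scons n m rho t :
  tvars (leq 1) t -> teval (scons n rho) t = teval (scons m rho) t.
Proof. by move/eq_teval; apply; case. Qed.

Lemma forces_mono P p q rho a : notion_of_forcing P -> ext P q p ->
  forces_env P p rho a -> forces_env P q rho a.
Proof.
move=> hP; have onth_mono u v r r' n :
    ext P u v -> onth (valuation P v) n = Some r -> r = r' ->
    onth (valuation P u) n = Some r'.
  move=> /(val_mono hP)/prefixP[s ->] h <-; rewrite onth_cat.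
  by case: ltnP h => // ?; rewrite onth_default.
elim: a p q rho => [t u|t u|t|t|a IHa b IHb|a IH|a IH] p q rho qp //=.
- by move/onth_mono; exact.
- by move/onth_mono; exact.
- by move=> [/(IHa _ _ _ qp) ? /(IHb _ _ _ qp)].
- by move=> h r rq; apply: h; exact: (ext_trans hP) rq qp.
- by move=> [n /(IH _ _ _ qp) ?]; exists n.
Qed.

Definition agrees (s : seq bool) (Y : set nat) :=
  forall n v, onth s n = Some v -> `[< Y n >] = v.

Lemma agrees_ext P p q Y : notion_of_forcing P -> ext P q p ->
  agrees (valuation P q) Y -> agrees (valuation P p) Y.
Proof.
move=> hP /(val_mono hP)/prefixP[s ->] h n v hn; apply: h.
by rewrite onth_cat; case: ltnP hn => // ?; rewrite onth_default.
Qed.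

Lemma agrees_self s : agrees s [set n | onth s n = Some true].
Proof.
move=> n v hn; apply/asboolP; case: v hn => //= ->; last by [].
Qed.


Lemma uniform_bound (Q : nat -> nat -> Prop) k :
  (forall n m m', m <= m' -> Q n m -> Q n m') ->
  (forall n, exists m, Q n m) -> exists m, forall n, n < k -> Q n m.
Proof.
move=> Qmono Qex; elim: k => [|k [m IH]]; first by exists 0.
have [m' Qkm'] := Qex k; exists (maxn m m') => n; rewrite ltnS leq_eqVlt.
case/predU1P => [->|/IH]; first by apply: Qmono Qkm'; exact: leq_maxr.
by apply: Qmono; exact: leq_maxl.
Qed.

(** The truth of a bounded formula depends on finitely many positions of [Y], and [N] is taken
    beyond all of them. Conditions this long settle negations as well. *)
Lemma bounded_decided P a rho : notion_of_forcing P -> bounded a ->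
  exists N, forall p Y, cond P p -> N <= size (valuation P p) ->
    agrees (valuation P p) Y -> (forces_env P p rho a <-> sat Y rho a).
Proof.
move=> hP ba; elim/bounded_ind: ba rho => {a} [t u|t u|t|t|a b IHa IHb|a IH|t a tb IH] rho /=.
- by exists 0.
- by exists 0.
- exists (teval rho t).+1 => p Y _ Np /(_ (teval rho t)); rewrite onthE (nth_map false) //.
  move=> /(_ _ erefl); case: nth => /asboolP; split => //.
- exists (teval rho t).+1 => p Y _ Np /(_ (teval rho t)); rewrite onthE (nth_map false) //.
  move=> /(_ _ erefl); case: nth => /asboolP; split => //.
- have [N hN] := IHa rho; have [M hM] := IHb rho; exists (maxn N M) => p Y Pp.
  rewrite geq_max => /andP[Np Mp] pY.
  by have := hN p Y Pp Np pY; have := hM p Y Pp Mp pY; tauto.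
- have [N hN] := IH rho; exists N => p Y Pp Np pY.
  split=> [h /(hN p Y Pp Np pY).2|h q qp hq]; first exact: h (ext_refl hP Pp).
  have [Pq _] := ext_cond hP qp.
  have Nq : N <= size (valuation P q).
    exact: leq_trans Np (size_prefix (val_mono hP qp)).
  (* If [q] forces [a], then [a] holds in the set read off the valuation of [q]. That set also
     agrees with [p], so [p] forces [a], and [a] holds in [Y]. *)
  apply: h; apply/(hN p Y Pp Np pY).
  apply/(hN p _ Pp Np (agrees_ext hP qp (@agrees_self _))).
  exact/(hN q _ Pq Nq (@agrees_self _)).
- have [||N hN] := @uniform_bound (fun n N => forall p Y, cond P p ->
      N <= size (valuation P p) -> agrees (valuation P p) Y ->
      (forces_env P p (scons n rho) a <-> sat Y (scons n rho) a)) (teval (scons 0 rho) t).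
  + by move=> n m m' mm' h p Y Pp /(leq_trans mm'); exact: h.
  + by move=> n; exact: IH.
  exists N => p Y Pp Np pY; split=> -[n [/= nt h]]; exists n; split=> //;
    apply/(hN n _ p Y Pp Np pY) => //; by rewrite -(teval_scons n).
Qed.

(** What the truth lemma for Sigma^0_1 formulas uses of a filter. A descending chain with growing
    valuations qualifies without being closed upwards. *)
Record generic_enough (P : forcing) (F : set nat) : Prop := GenericEnough {
  enough_cond : F `<=` cond P;
  enough_dir : forall p q, F p -> F q ->
    exists r, [/\ F r, ext P r p & ext P r q];
  enough_val : val_infinite P F
}.

Lemma agrees_val_filter P F p : notion_of_forcing P -> generic_enough P F ->
  F p -> agrees (valuation P p) (val_filter P F).
Proof.
move=> hP [_ dirF _] Fp n [] pn; apply/asboolP; first by exists p.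
move=> [q Fq qn]; have [r [_ rp rq]] := dirF p q Fp Fq.
have := agrees_ext hP rp (@agrees_self _) pn.
by rewrite (agrees_ext hP rq (@agrees_self _) qn).
Qed.

(** Some element of [F] is long enough to decide a given bounded formula, and every other element of
    [F] has a common extension with it. Leading existential quantifiers commute with both sides. *)
Lemma truth P F a rho : notion_of_forcing P -> generic_enough P F -> sigma1 a ->
  sat (val_filter P F) rho a <-> exists2 p, F p & forces_env P p rho a.
Proof.
move=> hP gF; have [Fc dirF valF] := gF.
have bdd b r : bounded b ->
    sat (val_filter P F) r b <-> exists2 p, F p & forces_env P p r b.
  move=> bb; have [N hN] := bounded_decided r hP bb; have [p Fp Np] := valF N.
  split=> [h|[q Fq hq]].
    by exists p => //; apply/(hN p _ (Fc _ Fp) Np (agrees_val_filter hP gF Fp)).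
  have [t [Ft tp tq]] := dirF p q Fp Fq.
  have Nt := leq_trans Np (size_prefix (val_mono hP tp)).
  apply/(hN t _ (Fc _ Ft) Nt (agrees_val_filter hP gF Ft)).
  exact: forces_mono hq.
elim: a rho => [t u|t u|t|t|a _ b _|a _|a IH] rho; 
  try by move=> sa; apply: bdd; move: sa; rewrite /= ?orbF.
move=> /orP[/bdd //|sa]; split=> [[n /IH-/(_ sa)[p Fp ?]]|[p Fp [n ?]]].
  by exists p => //; exists n.
by exists n; apply/IH => //; exists p.
Qed.

(** * Uniform definability *)

Fixpoint tsubst (s : nat -> term) (t : term) : term :=
  match t with
  | TVar k => s k
  | TZero => TZero
  | TSucc t => TSucc (tsubst s t)
  | TAdd t u => TAdd (tsubst s t) (tsubst s u)
  | TMul t u => TMul (tsubst s t) (tsubst s u)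
  end.

Definition up (s : nat -> term) (k : nat) : term :=
  if k is k'.+1 then tsubst (TVar \o succn) (s k') else TVar 0.

Fixpoint fsubst (s : nat -> term) (a : form) : form :=
  match a with
  | FEq t u => FEq (tsubst s t) (tsubst s u)
  | FLt t u => FLt (tsubst s t) (tsubst s u)
  | FIn t => FIn (tsubst s t)
  | FNotin t => FNotin (tsubst s t)
  | FAnd a b => FAnd (fsubst s a) (fsubst s b)
  | FNot a => FNot (fsubst s a)
  | FEx a => FEx (fsubst (up s) a)
  end.

Lemma teval_subst rho s t :
  teval rho (tsubst s t) = teval (teval rho \o s) t.
Proof. by elim: t => //= [t ->|t -> u ->|t -> u ->]. Qed.

Lemma teval_shift n rho t : teval (scons n rho) (tsubst (TVar \o succn) t) = teval rho t.
Proof. exact: teval_subst. Qed.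

Lemma sat_subst Y rho s a :
  sat Y rho (fsubst s a) <-> sat Y (teval rho \o s) a.
Proof.
elim: a rho s => [t u|t u|t|t|a IHa b IHb|a IH|a IH] rho s /=;
  rewrite ?teval_subst ?IHa ?IHb ?IH //.
suff E n : teval (scons n rho) \o up s = scons n (teval rho \o s).
  by split=> -[n]; rewrite ?IH ?E => h; exists n; rewrite ?IH ?E.
by apply/funext; case=> //= k; rewrite teval_subst.
Qed.

Lemma tvars_subst (b b' : pred nat) s t : (forall k, b k -> tvars b' (s k)) ->
  tvars b t -> tvars b' (tsubst s t).
Proof.
move=> bs; elim: t => //= [t IHt u IHu|t IHt u IHu] /andP[/IHt-> /IHu->] //.
Qed.

Lemma bounded_subst s a : bounded a -> bounded (fsubst s a).
Proof.
move=> ba; elim/bounded_ind: ba s => {a} //= [a b IHa IHb|t a tb IH] s.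
  by rewrite IHa IHb.
rewrite IH andbT; apply: tvars_subst tb => -[//|k] _ /=.
by apply: (@tvars_subst predT) => //; elim: (s k) => //= ? -> ? ->.
Qed.

(* The substitution need not be the identity on the free variables of the formula:
   sending the irrelevant ones to 0 closes it. *)
Lemma fclosed_subst n s a :
  (forall k, tvars (ltn^~ n) (s k)) -> Defs.fclosed n (fsubst s a).
Proof.
have tvT t : tvars predT t by elim: t => //= ? -> ? ->.
have tc m r t : (forall k, tvars (ltn^~ m) (r k)) -> tvars (ltn^~ m) (tsubst r t).
  by move=> h; apply: (@tvars_subst predT).
elim: a n s => [t u|t u|t|t|a IHa b IHb|a IH|a IH] n s sn /=;
  rewrite ?tc ?IHa ?IHb //; first exact: IH.
apply: IH => -[//|k] /=.
by apply: tvars_subst (sn k) => j.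
Qed.

(** The arguments are read off the environment as [rho 0], [rho 1], ..., which lets closure
    properties be proved semantically, with the formulas kept hidden. *)
Definition relation := set nat -> (nat -> nat) -> Prop.

Section Definability.
Variable K : set (set nat).

(* One formula has to serve all Y in K: a diagonal sentence is fixed before the
   Y in which it is evaluated. *)
Definition delta0 (R : relation) :=
  exists2 B, bounded B & forall Y, K Y -> forall rho, R Y rho <-> sat Y rho B.

Lemma delta0_ext R R' : delta0 R ->
  (forall Y, K Y -> forall rho, R' Y rho <-> R Y rho) -> delta0 R'.
Proof.
by move=> [B bB hB] h; exists B => // Y KY rho; rewrite h // hB.
Qed.

Lemma delta0_sat B : bounded B -> delta0 (fun Y rho => sat Y rho B).
Proof. by exists B. Qed.

Lemma delta0_and R R' : delta0 R -> delta0 R' ->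
  delta0 (fun Y rho => R Y rho /\ R' Y rho).
Proof.
move=> [B bB hB] [B' bB' hB']; exists (FAnd B B'); first by rewrite /= bB.
by move=> Y KY rho; rewrite /= hB ?hB'.
Qed.

Lemma delta0_not R : delta0 R -> delta0 (fun Y rho => ~ R Y rho).
Proof.
by move=> [B bB hB]; exists (FNot B) => // Y KY rho; rewrite /= hB.
Qed.

Lemma delta0_or R R' : delta0 R -> delta0 R' ->
  delta0 (fun Y rho => R Y rho \/ R' Y rho).
Proof.
move=> dR dR'; apply: delta0_ext (delta0_not (delta0_and (delta0_not dR) (delta0_not dR'))) _.
by move=> Y _ rho /=; have := EM (R Y rho); have := EM (R' Y rho); tauto.
Qed.

Lemma delta0_subst s R : delta0 R -> delta0 (fun Y rho => R Y (teval rho \o s)).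
Proof.
move=> [B bB hB]; exists (fsubst s B); first exact: bounded_subst.
by move=> Y KY rho; rewrite sat_subst hB.
Qed.

Lemma delta0_bex t R : delta0 R -> delta0 (fun Y rho =>
  exists2 n, n < teval rho t & R Y (scons n rho)).
Proof.
move=> [B bB hB]; exists (FEx (FAnd (FLt (TVar 0) (tsubst (TVar \o succn) t)) B)).
  rewrite /= bB andbT.
  by apply: (@tvars_subst predT) => //; elim: t => //= ? -> ? ->.
move=> Y KY rho /=; split=> [[n nt /hB h]|[n [nt /hB h]]]; exists n => //.
  by split; [rewrite teval_subst | exact: h].
  by move: nt; rewrite teval_subst.
exact: h.
Qed.

Lemma delta0_ball t R : delta0 R -> delta0 (fun Y rho =>
  forall n, n < teval rho t -> R Y (scons n rho)).
Proof.
move=> dR; apply: delta0_ext (delta0_not (delta0_bex t (delta0_not dR))) _.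
move=> Y _ rho /=; split=> [h [n /h]//|h n nt].
by apply: contrapT => nR; apply: h; exists n.
Qed.

Definition sigma (R : relation) := exists2 Q, delta0 Q &
  forall Y, K Y -> forall rho, R Y rho <-> exists w, Q Y (scons w rho).

Lemma sigma_ext R R' : sigma R ->
  (forall Y, K Y -> forall rho, R' Y rho <-> R Y rho) -> sigma R'.
Proof. by move=> [Q dQ hQ] h; exists Q => // Y KY rho; rewrite h // hQ. Qed.

Lemma delta0_sigma R : delta0 R -> sigma R.
Proof.
move=> dR; exists (fun Y rho => R Y (rho \o succn)).
  exact: (@delta0_subst (TVar \o succn) R dR).
by move=> Y KY rho; split=> [|[]//]; exists 0.
Qed.

Lemma sigma_subst s R : sigma R -> sigma (fun Y rho => R Y (teval rho \o s)).
Proof.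
move=> [Q dQ hQ]; exists (fun Y rho => Q Y (teval rho \o up s)).
  exact: delta0_subst.
move=> Y KY rho; rewrite hQ //.
suff E w : teval (scons w rho) \o up s = scons w (teval rho \o s).
  by split=> -[w h]; exists w; rewrite ?E // -E.
by apply/funext; case=> //= k; rewrite teval_subst.
Qed.

(** Pairing is not a term of the language, so the two quantifiers are merged into one common bound
    [w] on both witnesses. *)
Lemma sigma_ex R : sigma R -> sigma (fun Y rho => exists n, R Y (scons n rho)).
Proof.
move=> [Q dQ hQ].
(* The environment of the kernel starts with [v], [n], [w]; the substitution skips the bound [w]. *)
pose s k := match k with 0 => TVar 0 | 1 => TVar 1 | k.+2 => TVar k.+3 end.
exists (fun Y rho => exists2 n, n < teval rho (TVar 0) &
    exists2 v, v < teval (scons n rho) (TVar 1) &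
      Q Y (teval (scons v (scons n rho)) \o s)).
  apply: (@delta0_bex (TVar 0) (fun Y rho => exists2 v, v < teval rho (TVar 1) &
      Q Y (teval (scons v rho) \o s))).
  apply: (@delta0_bex (TVar 1) (fun Y rho => Q Y (teval rho \o s))).
  exact: delta0_subst.
have E v n w rho : teval (scons v (scons n (scons w rho))) \o s = scons v (scons n rho).
  by apply/funext; case=> [|[|k]].
move=> Y KY rho; split=> [[n /hQ-/(_ KY)[v h]]|[w [n _ [v _]]]].
  by exists (n + v).+1, n; [rewrite /=; lia | exists v; [rewrite /=; lia | rewrite E]].
by rewrite E => h; exists n; apply/hQ => //; exists v.
Qed.

Lemma sigma_and R R' : sigma R -> sigma R' ->
  sigma (fun Y rho => R Y rho /\ R' Y rho).
Proof.
move=> [Q dQ hQ] [Q' dQ' hQ'].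
pose s k := match k with 0 => TVar 1 | k.+1 => TVar k.+2 end.
pose s' k := match k with 0 => TVar 0 | k.+1 => TVar k.+2 end.
apply: (@sigma_ext (fun Y rho => exists w w',
    Q Y (teval (scons w' (scons w rho)) \o s) /\ Q' Y (teval (scons w' (scons w rho)) \o s'))).
  apply: (@sigma_ex (fun Y rho => exists w',
    Q Y (teval (scons w' rho) \o s) /\ Q' Y (teval (scons w' rho) \o s'))).
  apply: (@sigma_ex (fun Y rho => Q Y (teval rho \o s) /\ Q' Y (teval rho \o s'))).
  by apply: delta0_sigma; apply: delta0_and; exact: delta0_subst.
have E w w' rho : teval (scons w' (scons w rho)) \o s = scons w rho.
  by apply/funext; case.
have E' w w' rho : teval (scons w' (scons w rho)) \o s' = scons w' rho.
  by apply/funext; case.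
move=> Y KY rho; rewrite hQ // hQ' //; split=> [[[w h] [w' h']]|[w [w' []]]].
  by exists w, w'; rewrite E E'.
by rewrite E E' => h h'; split; [exists w | exists w'].
Qed.

Lemma sigma_or R R' : sigma R -> sigma R' ->
  sigma (fun Y rho => R Y rho \/ R' Y rho).
Proof.
move=> [Q dQ hQ] [Q' dQ' hQ']; exists (fun Y rho => Q Y rho \/ Q' Y rho).
  exact: delta0_or.
move=> Y KY rho; rewrite hQ // hQ' //; split=> [[[w h]|[w h]]|[w [h|h]]].
- by exists w; left.
- by exists w; right.
- by left; exists w.
- by right; exists w.
Qed.

(** Collection: the finitely many witnesses have a common bound, which becomes the leading
    quantifier. *)
Lemma sigma_ball t R : sigma R -> sigma (fun Y rho =>
  forall n, n < teval rho t -> R Y (scons n rho)).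
Proof.
move=> [Q dQ hQ].
pose s k := match k with 0 => TVar 0 | 1 => TVar 1 | k.+2 => TVar k.+3 end.
exists (fun Y rho => forall n, n < teval rho (tsubst (TVar \o succn) t) ->
    exists2 v, v < teval (scons n rho) (TVar 1) &
      Q Y (teval (scons v (scons n rho)) \o s)).
  apply: (@delta0_ball _ (fun Y rho => exists2 v, v < teval rho (TVar 1) &
      Q Y (teval (scons v rho) \o s))).
  apply: (@delta0_bex (TVar 1) (fun Y rho => Q Y (teval rho \o s))).
  exact: delta0_subst.
have E v n w rho : teval (scons v (scons n (scons w rho))) \o s = scons v (scons n rho).
  by apply/funext; case=> [|[|k]].
move=> Y KY rho; split=> [h|[w h] n nt].
  have [||w hw] := @uniform_bound (fun n w => n < teval rho t ->
      exists2 v, v < w & Q Y (scons v (scons n rho))) (teval rho t).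
  - by move=> n m m' mm' q /q[v vm qv]; exists v => //; exact: leq_trans mm'.
  - move=> n; have [nt|nt] := boolP (n < teval rho t); last by exists 0.
    have /hQ-/(_ KY)[v hv] := h n nt.
    by exists v.+1 => _; exists v.
  exists w => n; rewrite teval_subst => nt.
  by have [v vw qv] := hw n nt nt; exists v => //; rewrite E.
apply/hQ => //; have [|v _] := h n; first by rewrite teval_subst.
by rewrite E => hv; exists v.
Qed.

Lemma sigma_eq t u : sigma (fun Y rho => teval rho t = teval rho u).
Proof. exact: delta0_sigma (@delta0_sat (FEq t u) isT). Qed.

Lemma sigma_lt t u : sigma (fun Y rho => teval rho t < teval rho u).
Proof. exact: delta0_sigma (@delta0_sat (FLt t u) isT). Qed.

End Definability.

(** * Recursive functions are definable *)

(** After doubling, the graph of the Cantor pairing is a polynomial equation, hence an atomic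
    formula. *)
Lemma npair_poly x y : (npair x y).*2 = y.*2 + (x + y) * (x + y).+1.
Proof.
rewrite /npair /Cantor.to_nat; set F := nat_rec _ _ _.
have E n : (F n).*2 = n * n.+1 by elim: n => //= n IH; rewrite -/F; lia.
have -> : Nat.add y x = x + y by lia.
by have := E (x + y); lia.
Qed.

Lemma npair_eq p x y :
  p = npair x y <-> p + p = y + y + (x + y) * (x + y).+1.
Proof. by have := npair_poly x y; lia. Qed.

(** A common prime divisor divides the difference [(j - i) * d], hence [d], since [j - i] divides
    the factorial of [n]. It then divides 1. *)
Lemma beta_coprime n d i j : n`! %| d -> i < j <= n ->
  coprime (i.+1 * d).+1 (j.+1 * d).+1.
Proof.
move=> nd /andP[ij jn]; rewrite /coprime -dvdn1; apply/negPn/negP => g1.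
set g := gcdn _ _ in g1; have g0 : 1 < g by rewrite ltn_neqAle eq_sym -dvdn1 g1 gcdn_gt0.
have pp := pdiv_prime g0; set p := pdiv g in pp.
have pi : p %| (i.+1 * d).+1 := dvdn_trans (pdiv_dvd g) (dvdn_gcdl _ _).
have pj : p %| (j.+1 * d).+1 := dvdn_trans (pdiv_dvd g) (dvdn_gcdr _ _).
have pd : p %| d.
  have : p %| (j.+1 * d).+1 - (i.+1 * d).+1 by rewrite dvdn_sub.
  rewrite subSS -mulnBl subSS Euclid_dvdM // => /orP[pij|//].
  apply: dvdn_trans nd; apply: dvdn_trans pij _.
  by apply: dvdn_fact; rewrite subn_gt0 ij (leq_trans (leq_subr _ _)).
have : p %| 1 by rewrite -(dvdn_addr _ (dvdn_mull i.+1 pd)) addn1.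
by rewrite dvdn1; case: eqP pp => // ->.
Qed.

(** Goedel's beta function. The factorial [d] makes the moduli pairwise coprime and larger than all
    the values, and the Chinese remainder theorem produces [c] one value at a time. *)
Lemma beta_seq (s : nat -> nat) n :
  exists c d, forall i, i <= n -> c %% (i.+1 * d).+1 = s i.
Proof.
pose M := n + \sum_(i < n.+1) s i; pose d := M`!.
have d_ge : M <= d by exact: fact_geq.
have sM i : i <= n -> s i <= d.
  move=> ile; apply: leq_trans d_ge; rewrite /M (bigD1 (Ordinal (ile : i < n.+1))) //=.
  by rewrite addnCA leq_addr.
have nd : n`! %| d by rewrite /d -(bin_fact (leq_addr _ n)) dvdn_mull // dvdn_mulr.
suff H k : k <= n.+1 -> exists c, forall i, i < k -> c %% (i.+1 * d).+1 = s i.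
  by have [c hc] := H _ (leqnn _); exists c, d => i ile; exact: hc.
elim: k => [|k IH] kn; first by exists 0.
have [c hc] := IH (ltnW kn).
pose m1 := \prod_(i < k) (i.+1 * d).+1.
have co : coprime m1 (k.+1 * d).+1.
  rewrite /m1; elim/big_ind: _ => [|x y|i _]; first exact: coprime1n.
    by rewrite coprimeMl => -> ->.
  by apply: beta_coprime nd _; rewrite ltn_ord.
exists (chinese m1 (k.+1 * d).+1 c (s k)) => i; rewrite ltnS leq_eqVlt.
case/predU1P => [->|ik].
  rewrite chinese_modr // modn_small // ltnS (leq_trans (sM k kn)) //.
  by rewrite leq_pmull.
have dv : (i.+1 * d).+1 %| m1 by rewrite /m1 (bigD1 (Ordinal ik)) //= dvdn_mulr.
by rewrite -(hc i ik) -(modn_dvdm _ dv) chinese_modl // modn_dvdm.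
Qed.

(** Unrolls the recursion into the sequence of its values, which [beta_seq] codes by two numbers. *)
Lemma eval_recE A f g x y : eval A (CRec f g) x y <->
  exists s : nat -> nat, [/\ eval A f (nfst x) (s 0),
    forall m, m < nsnd x -> eval A g (npair (nfst x) (npair m (s m))) (s m.+1)
    & s (nsnd x) = y].
Proof.
rewrite /=; elim: (nsnd x) y => [|n IH] y; split.
- by move=> /= fy; exists (fun=> y).
- by move=> [s [s0 _ /= <-]].
- move=> /= [z /IH[s [s0 sn sz]] gy].
  exists (fun m => if m <= n then s m else y); split; rewrite ?leq0n ?ltnn //.
  move=> m; rewrite ltnS => mn; rewrite mn; case: ltnP => h; first exact: sn.
  have -> : m = n by lia.
  by rewrite sz.
- move=> /= [s [s0 sn <-]]; exists (s n); last exact: sn.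
  by apply/IH; exists s; split=> // m /ltnW; exact: sn.
Qed.

Section EvalDefinable.
Variable K : set (set nat).

Lemma sigma_npair t u v :
  sigma K (fun Y rho => teval rho v = npair (teval rho t) (teval rho u)).
Proof.
apply: sigma_ext (sigma_eq K (TAdd v v) (TAdd (TAdd u u)
  (TMul (TAdd t u) (TSucc (TAdd t u))))) _.
by move=> Y _ rho; rewrite npair_eq.
Qed.

Lemma sigma_beta c d i v : sigma K (fun Y rho =>
  teval rho c %% ((teval rho i).+1 * teval rho d).+1 = teval rho v).
Proof.
pose sh := tsubst (TVar \o succn).
apply: sigma_ext (sigma_and (sigma_lt K v (TSucc (TMul (TSucc i) d)))
  (sigma_ex (sigma_eq K (sh c)
    (TAdd (TMul (TVar 0) (TSucc (TMul (TSucc (sh i)) (sh d)))) (sh v))))) _.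
move=> Y _ rho /=; split=> [cv|[vm [k]]].
  split; first by rewrite -cv ltn_pmod.
  exists (teval rho c %/ ((teval rho i).+1 * teval rho d).+1).
  by rewrite !teval_shift -cv -divn_eq.
by rewrite !teval_shift => ->; rewrite modnMDl modn_small.
Qed.

Lemma sigma2 (E : nat -> nat -> Prop) : sigma K (fun Y rho => E (rho 0) (rho 1)) ->
  forall t u, sigma K (fun Y rho => E (teval rho t) (teval rho u)).
Proof.
by move=> sE t u; exact: (sigma_subst (fun k => if k is 0 then t else u) sE).
Qed.

Variable A : set nat.
Hypothesis sigma_oracle : sigma K (fun Y rho => rho 1 = `[< A (rho 0) >]).

(** The oracle enters through [sigma_oracle] alone. It may be the set [Y] itself, or a set that one
    pair of formulas defines in every [Y] of [K]. *)
Lemma sigma_eval c : sigma K (fun Y rho => eval A c (rho 0) (rho 1)).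
Proof.
elim: c => [|||||f IHf g IHg|f IHf g IHg|f IHf g IHg|f IHf].
- exact: (sigma_eq K (TVar 1) TZero).
- exact: (sigma_eq K (TVar 1) (TSucc (TVar 0))).
- apply: sigma_ext (sigma_ex (sigma_npair (TVar 2) (TVar 0) (TVar 1))) _.
  move=> Y _ rho /=; split=> [->|[b ->]]; last by rewrite nfst_pair.
  by exists (nsnd (rho 0)); rewrite npairK.
- apply: sigma_ext (sigma_ex (sigma_npair (TVar 0) (TVar 2) (TVar 1))) _.
  move=> Y _ rho /=; split=> [->|[b ->]]; last by rewrite nsnd_pair.
  by exists (nfst (rho 0)); rewrite npairK.
- exact: sigma_oracle.
- apply: sigma_ext (sigma_ex (sigma_ex (sigma_and (sigma2 IHf (TVar 2) (TVar 1))
    (sigma_and (sigma2 IHg (TVar 2) (TVar 0))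
      (sigma_npair (TVar 1) (TVar 0) (TVar 3)))))) _.
  by move=> Y _ rho /=; split=> -[a [b]] => [[]|[? []]]; exists a, b.
- apply: sigma_ext (sigma_ex (sigma_and (sigma2 IHg (TVar 1) (TVar 0))
    (sigma2 IHf (TVar 0) (TVar 2)))) _.
  by move=> Y _ rho /=; split=> -[z] => [|[]]; exists z.
(* The outer witnesses are the components [a], [n] of the argument and the beta code [c], [d] of the
   values. The inner ones are the argument of [g], its second component, the next value and the
   current value. *)
- apply: sigma_ext (sigma_ex (sigma_ex (sigma_ex (sigma_ex (sigma_and
    (sigma_npair (TVar 3) (TVar 2) (TVar 4)) (sigma_and
      (sigma_ex (sigma_and (sigma_beta (TVar 2) (TVar 1) TZero (TVar 0))
        (sigma2 IHf (TVar 4) (TVar 0)))) (sigma_and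
      (sigma_ball (TVar 2) (sigma_ex (sigma_ex (sigma_ex (sigma_ex (sigma_and
        (sigma_beta (TVar 6) (TVar 5) (TVar 4) (TVar 0)) (sigma_and
        (sigma_beta (TVar 6) (TVar 5) (TSucc (TVar 4)) (TVar 1)) (sigma_and
        (sigma_npair (TVar 4) (TVar 0) (TVar 2)) (sigma_and
        (sigma_npair (TVar 8) (TVar 2) (TVar 3))
        (sigma2 IHg (TVar 3) (TVar 1))))))))))) 
      (sigma_beta (TVar 1) (TVar 0) (TVar 2) (TVar 5))))))))) _.
  move=> Y _ rho; rewrite eval_recE /=; split=> [[s [s0 sn sy]]|].
    have [c [d cd]] := beta_seq s (nsnd (rho 0)).
    exists (nfst (rho 0)), (nsnd (rho 0)), c, d; rewrite npairK cd //.
    split=> //; split; first by exists (s 0); split=> //; exact: cd.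
    split; last by rewrite -sy; exact: cd.
    move=> m mn; exists (npair (nfst (rho 0)) (npair m (s m))), (npair m (s m)).
    exists (s m.+1), (s m); rewrite !cd //; last exact: ltnW.
    by do !split; exact: sn.
  move=> [a [n [c [d [-> [[z [<- f0]] [gn <-]]]]]]].
  rewrite nfst_pair nsnd_pair; exists (fun i => c %% (i.+1 * d).+1); split=> // m mn.
  by have [w [u [z2 [z1 [<- [<- [-> [-> ?]]]]]]]] := gn m mn.
- have IH := sigma2 IHf; apply: sigma_ext (sigma_and
    (sigma_ex (sigma_and (sigma_npair (TVar 1) (TVar 2) (TVar 0)) (IH (TVar 0) TZero)))
    (sigma_ball (TVar 1) (sigma_ex (sigma_ex (sigma_and
      (sigma_npair (TVar 3) (TVar 2) (TVar 0)) (IH (TVar 0) (TSucc (TVar 1)))))))) _.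
  move=> Y _ rho /=; split=> [[h0 h]|[[p [-> h0]] h]].
    split; first by exists (npair (rho 0) (rho 1)).
    by move=> z /h[v hv]; exists v, (npair (rho 0) z).
  by split=> // z /h[v [q [-> ?]]]; exists v.
Qed.
End EvalDefinable.

(** * Relativized recursive functions *)

Section Computability.
Variable A : set nat.

Definition rec_fun (f : nat -> nat) := exists c, forall x, eval A c x (f x).
Definition rec_pred (R : nat -> Prop) := rec_fun (fun x => `[< R x >]).

Lemma rec_id : rec_fun (fun x => x).
Proof.
by exists (CPair CFst CSnd) => x /=; exists (nfst x), (nsnd x); rewrite npairK.
Qed.

Lemma rec_comp g f : rec_fun g -> rec_fun f -> rec_fun (fun x => g (f x)).
Proof. by move=> [c hc] [d hd]; exists (CComp c d) => x; exists (f x). Qed.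

Lemma rec_succ f : rec_fun f -> rec_fun (fun x => (f x).+1).
Proof. by apply: rec_comp; exists CSucc. Qed.

Lemma rec_const n : rec_fun (fun=> n).
Proof. by elim: n => [|n /rec_succ//]; exists CZero. Qed.

Lemma rec_fst f : rec_fun f -> rec_fun (fun x => nfst (f x)).
Proof. by apply: rec_comp; exists CFst. Qed.

Lemma rec_snd f : rec_fun f -> rec_fun (fun x => nsnd (f x)).
Proof. by apply: rec_comp; exists CSnd. Qed.

Lemma rec_pair f g : rec_fun f -> rec_fun g -> rec_fun (fun x => npair (f x) (g x)).
Proof.
by move=> [c hc] [d hd]; exists (CPair c d) => x /=; exists (f x), (g x).
Qed.

Lemma rec_natrec a n (g : nat -> nat -> nat -> nat) : rec_fun a -> rec_fun n ->
  rec_fun (fun u => g (nfst u) (nfst (nsnd u)) (nsnd (nsnd u))) ->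
  rec_fun (fun x => nat_rec (fun=> nat) (a x) (g x) (n x)).
Proof.
move=> [ca ha] cn [cg hg].
have [d hd] : rec_fun (fun u => nat_rec (fun=> nat) (a (nfst u)) (g (nfst u)) (nsnd u)).
  exists (CRec ca cg) => u /=; elim: (nsnd u) => [|m IH]; first exact: ha.
  set z := nat_rec _ _ _ m in IH *; exists z => //.
  by have := hg (npair (nfst u) (npair m z)); rewrite !(nfst_pair, nsnd_pair).
have [e he] := rec_comp (ex_intro _ d hd) (rec_pair rec_id cn).
by exists e => x; have := he x; rewrite nfst_pair nsnd_pair.
Qed.

Lemma rec_ext f g : rec_fun f -> f =1 g -> rec_fun g.
Proof. by move=> [c hc] fg; exists c => x; rewrite -fg. Qed.

Lemma recp_ext R S : rec_pred R -> (forall x, S x <-> R x) -> rec_pred S.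
Proof.
by move=> cR RS; apply: rec_ext cR _ => x; rewrite (propext (RS x)).
Qed.

Lemma rec_if R f g : rec_pred R -> rec_fun f -> rec_fun g ->
  rec_fun (fun x => if `[< R x >] then f x else g x).
Proof.
move=> cR cf cg; apply: rec_ext (@rec_natrec g _ (fun x _ _ => f x) cg cR _) _.
  by apply: rec_comp cf _; exact: rec_fst rec_id.
by move=> x; case: asboolP.
Qed.

(* Recursion on the truth value of R, as a number, evaluates the partial function
   only where R holds. *)
Lemma rec_guard R c f : rec_pred R -> (forall x, R x -> eval A c x (f x)) ->
  rec_fun (fun x => if `[< R x >] then f x else 0).
Proof.
move=> [r hr] cf.
exists (CComp (CRec CZero (CComp c CFst)) (CPair (CPair CFst CSnd) r)) => x.
exists (npair x `[< R x >]).
  exists x, `[< R x >]; split=> //; exists (nfst x), (nsnd x).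
  by rewrite npairK.
rewrite /= !nsnd_pair nfst_pair; case: asboolP => //= Rx.
by exists 0 => //; exists x; [rewrite nfst_pair | exact: cf].
Qed.

Lemma rec_predn f : rec_fun f -> rec_fun (fun x => (f x).-1).
Proof.
move=> cf; apply: rec_ext
  (@rec_natrec (fun=> 0) _ (fun _ m _ => m) (rec_const 0) cf _) _.
  exact: rec_fst (rec_snd rec_id).
by move=> x; case: (f x).
Qed.

Lemma rec_add f g : rec_fun f -> rec_fun g -> rec_fun (fun x => f x + g x).
Proof.
move=> cf cg; apply: rec_ext
  (@rec_natrec _ _ (fun _ _ z => z.+1) cf cg _) _.
  exact: rec_succ (rec_snd (rec_snd rec_id)).
by move=> x /=; elim: (g x) => [|n /= ->]; rewrite ?addn0 ?addnS.
Qed.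

Lemma rec_sub f g : rec_fun f -> rec_fun g -> rec_fun (fun x => f x - g x).
Proof.
move=> cf cg; apply: rec_ext
  (@rec_natrec _ _ (fun _ _ z => z.-1) cf cg _) _.
  exact: rec_predn (rec_snd (rec_snd rec_id)).
by move=> x /=; elim: (g x) => [|n /= ->]; rewrite ?subn0 ?subnS.
Qed.

Lemma recp_le f g : rec_fun f -> rec_fun g -> rec_pred (fun x => f x <= g x).
Proof.
move=> cf cg; apply: rec_ext (rec_sub (rec_const 1) (rec_sub cf cg)) _.
by move=> x; rewrite asboolb; case: leqP; lia.
Qed.

Lemma recp_lt f g : rec_fun f -> rec_fun g -> rec_pred (fun x => f x < g x).
Proof. by move=> cf cg; exact: recp_le (rec_succ cf) cg. Qed.

Lemma recp_not R : rec_pred R -> rec_pred (fun x => ~ R x).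
Proof.
move=> cR; apply: rec_ext (rec_sub (rec_const 1) cR) _ => x.
by rewrite asbool_neg; case: asbool.
Qed.

Lemma recp_and R S : rec_pred R -> rec_pred S -> rec_pred (fun x => R x /\ S x).
Proof.
move=> cR cS; apply: rec_ext (rec_sub (rec_add cR cS) (rec_const 1)) _ => x.
by rewrite asbool_and; do 2 case: asbool.
Qed.

Lemma recp_or R S : rec_pred R -> rec_pred S -> rec_pred (fun x => R x \/ S x).
Proof.
move=> cR cS; apply: recp_ext (recp_not (recp_and (recp_not cR) (recp_not cS))) _.
by move=> x; have := EM (R x); have := EM (S x); tauto.
Qed.

Lemma recp_imp R S : rec_pred R -> rec_pred S -> rec_pred (fun x => R x -> S x).
Proof.
move=> cR cS; apply: recp_ext (recp_or (recp_not cR) cS) _.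
by move=> x; have := EM (R x); tauto.
Qed.

Lemma recp_eq f g : rec_fun f -> rec_fun g -> rec_pred (fun x => f x = g x).
Proof.
move=> cf cg; apply: recp_ext (recp_and (recp_le cf cg) (recp_le cg cf)) _.
by move=> x; lia.
Qed.

Lemma recp_comp R f : rec_pred R -> rec_fun f -> rec_pred (fun x => R (f x)).
Proof. exact: (@rec_comp (fun x => `[< R x >])). Qed.

Lemma recp_bex n (R : nat -> nat -> Prop) : rec_fun n ->
  rec_pred (fun u => R (nfst u) (nsnd u)) ->
  rec_pred (fun x => exists2 z, z < n x & R x z).
Proof.
move=> cn cR; apply: rec_ext (@rec_natrec (fun=> 0) _
  (fun x m z => if `[< R x m >] then 1 else z) (rec_const 0) cn _) _.
  apply: (rec_if (R := fun u => R (nfst u) (nfst (nsnd u)))).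
  - have ci := rec_pair (rec_fst rec_id) (rec_fst (rec_snd rec_id)).
    apply: recp_ext (recp_comp cR ci) _ => x.
    by rewrite nfst_pair nsnd_pair.
  - exact: rec_const.
  - exact: rec_snd (rec_snd rec_id).
move=> x; elim: (n x) => [|m /= ->] /=.
  by case: asboolP => // -[].
case: asboolP => Rm; first by case: asboolP => // -[]; exists m.
congr nat_of_bool; apply/asboolP/asboolP => -[z zm Rz]; exists z => //.
  exact: ltnW.
by rewrite ltn_neqAle -ltnS zm andbT; apply/eqP => zE; rewrite zE in Rz.
Qed.

Lemma recp_ball n (R : nat -> nat -> Prop) : rec_fun n ->
  rec_pred (fun u => R (nfst u) (nsnd u)) ->
  rec_pred (fun x => forall z, z < n x -> R x z).
Proof.
move=> cn cR; apply: recp_ext (recp_not (recp_bex cn (R := fun x z => ~ R x z) (recp_not cR))) _.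
move=> x; split=> [h [z /h]//|h z zn].
by apply: contrapT => nR; apply: h; exists z.
Qed.

Lemma rec_search (R : nat -> nat -> Prop) :
  rec_pred (fun u => R (nfst u) (nsnd u)) -> (forall x, exists y, R x y) ->
  exists2 g, rec_fun g & forall x, R x (g x).
Proof.
(* [CMu] searches for a zero, so it is applied to the truth value of the negation. *)
move=> cR exR; have [d hd] := recp_not cR.
have exR' x : exists y, `[< R x y >] by have [y] := exR x; exists y; apply/asboolP.
pose g x := ex_minn (exR' x).
have gP x : R x (g x) by rewrite /g; case: ex_minnP => y /asboolP.
exists g => //; exists (CMu d) => x /=; split.
  have := hd (npair x (g x)); rewrite nfst_pair nsnd_pair.
  by case: asboolP => // /(_ (gP x)).
move=> z zg; exists 0; have := hd (npair x z); rewrite nfst_pair nsnd_pair.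
case: asboolP => // /contrapT Rxz; move: zg; rewrite /g; case: ex_minnP => m _.
by move=> /(_ z); rewrite asboolT // ltnNge => ->.
Qed.

End Computability.

(** * Diagonalization *)

Definition numeral (n : nat) : term := iter n TSucc TZero.

Lemma teval_numeral rho n : teval rho (numeral n) = n.
Proof. by elim: n => //= n ->. Qed.

(** The counterpart of [inst] on codes, with [e] standing for the code of [B]. *)
Definition inst_code (e x : nat) : nat :=
  npair 6 (npair 6 (npair 4
    (npair (npair 0 (npair (npair 0 0) (term_code (numeral x)))) e))).

Lemma rec_inst_code A e x : rec_fun A e -> rec_fun A x ->
  rec_fun A (fun u => inst_code (e u) (x u)).
Proof.
move=> ce cx; have cn : rec_fun A (fun u => term_code (numeral (x u))).
  apply: rec_ext (rec_natrec (rec_const A (npair 1 0)) cx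
    (g := fun _ _ z => npair 2 z) _) _.
    by apply: rec_pair; [exact: rec_const | exact: rec_snd (rec_snd (rec_id A))].
  by move=> u; elim: (x u) => //= n ->.
by do ![apply: rec_pair || exact: rec_const || exact: ce || exact: cn].
Qed.

Lemma form_dec_rec_fuel k k' n : n < k -> n < k' ->
  form_dec_rec k n = form_dec_rec k' n.
Proof.
elim: k k' n => // k IH [//|k'] n; rewrite !ltnS => nk nk' /=.
have := npair_ge (nfst n) (nsnd n); rewrite npairK => len.
have := npair_ge (nfst (nsnd n)) (nsnd (nsnd n)); rewrite npairK => len'.
case E : (nfst n) len => [|[|[|[|[|[|m]]]]]] // len.
- by rewrite !(IH k') //; lia.
- by rewrite (IH k') //; lia.
- by rewrite (IH k') //; lia.
Qed.

(** The numeral is inserted by an equation instead of a substitution, so that the code of [B] occurs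
    unchanged in the code of the instance. In [B], variable 0 is the argument and variable 1 the
    witness. *)
Definition inst (B : form) (x : nat) : form :=
  FEx (FEx (FAnd (FEq (TVar 0) (numeral x)) B)).

(** Here [e] is an arbitrary number, possibly outside the range of [form_code], so the argument goes
    through the independence of decoding from its fuel. *)
Lemma form_dec_inst e x : form_dec (inst_code e x) = inst (form_dec e) x.
Proof.
have fuel n k : n <= k -> form_dec n = form_dec_rec k.+4 n.
  by move=> nk; apply: form_dec_rec_fuel; lia.
have [k ek ->] : exists2 k, e <= k &
    form_dec (inst_code e x) = form_dec_rec k.+4 (inst_code e x).
  by exists (inst_code e x + e); [exact: leq_addl | exact: fuel (leq_addr _ _)].
have dec_ex j m : form_dec_rec j.+1 (npair 6 m) = FEx (form_dec_rec j m).
  by move: (npair 6 m) (nfst_pair 6 m) (nsnd_pair 6 m) => n /= -> ->.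
have dec_and j a b : form_dec_rec j.+1 (npair 4 (npair a b)) =
    FAnd (form_dec_rec j a) (form_dec_rec j b).
  move: (npair 4 _) (nfst_pair 4 (npair a b)) (nsnd_pair 4 (npair a b)) => n /= -> ->.
  by rewrite nfst_pair nsnd_pair.
have dec_eq j t u : form_dec_rec j.+1 (npair 0 (npair t u)) = FEq (term_dec t) (term_dec u).
  move: (npair 0 _) (nfst_pair 0 (npair t u)) (nsnd_pair 0 (npair t u)) => n /= -> ->.
  by rewrite nfst_pair nsnd_pair.
rewrite /inst_code !dec_ex dec_and dec_eq (term_codeK (TVar 0)) term_codeK.
by congr (FEx (FEx (FAnd _ _))); exact: (@form_dec_rec_fuel k.+1).
Qed.


Lemma sat_inst Y rho B x :
  sat Y rho (inst B x) <-> exists w, sat Y (scons x (scons w rho)) B.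
Proof.
split=> /= -[w]; first by move=> [v []]; rewrite teval_numeral => -> ?; exists w.
by move=> h; exists w, x; rewrite teval_numeral.
Qed.

Lemma sigma1_sentence_inst B x :
  sigma1_sentence (inst B x) = Defs.fclosed 2 B && bounded B.
Proof.
by rewrite /sigma1_sentence /= orbF; elim: x => //= x.
Qed.

(** No truth predicate is formalized: [e] is fixed, so all instances share the one formula
    [form_dec e], or else they all default to 0 = 0. *)
Lemma sigma_sentence K e : sigma K (fun Y rho =>
  sat Y (fun=> 0) (sigma1_enum (inst_code e (rho 0)))).
Proof.
have E x : sigma1_enum (inst_code e x) =
    if Defs.fclosed 2 (form_dec e) && bounded (form_dec e) then inst (form_dec e) x
    else FEq TZero TZero.
  by rewrite /sigma1_enum form_dec_inst sigma1_sentence_inst.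
have [vB|nB] := boolP (Defs.fclosed 2 (form_dec e) && bounded (form_dec e)); last first.
  by apply: sigma_ext (sigma_eq K TZero TZero) _ => Y _ rho; rewrite E (negPf nB).
(* [inst] puts the argument before the witness, [sigma] the witness before the argument. *)
pose s k := match k with 0 => TVar 1 | 1 => TVar 0 | _ => TZero end.
exists (fun Y rho => sat Y (teval rho \o s) (form_dec e)).
  by apply: delta0_subst (delta0_sat K _); case/andP: vB.
move=> Y _ rho; rewrite E vB sat_inst.
suff F w : teval (scons w rho) \o s = scons (rho 0) (scons w (fun=> 0)).
  by split=> -[w h]; exists w; rewrite ?F // -F.
by apply/funext; case=> [|[|k]].
Qed.

(** The kernel of a [sigma] relation is one formula for all of [K]. Closed up by sending the
    variables beyond the first two to 0, it has a code that serves every [Y] in [K]. *)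
Lemma sigma_index K (R : nat -> Prop) : sigma K (fun Y rho => R (rho 0)) ->
  exists e, forall Y, K Y -> forall x,
    R x <-> sat Y (fun=> 0) (sigma1_enum (inst_code e x)).
Proof.
move=> [Q [B bB hB] hQ].
pose s k := match k with 0 => TVar 1 | 1 => TVar 0 | _ => TZero end.
exists (form_code (fsubst s B)) => Y KY x.
have c2 : Defs.fclosed 2 (fsubst s B).
  by apply: fclosed_subst => -[|[|k]].
rewrite /sigma1_enum form_dec_inst form_codeK sigma1_sentence_inst c2.
rewrite (bounded_subst s bB) sat_inst.
have -> : R x <-> exists w, sat Y (scons w (scons x (fun=> 0))) B.
  rewrite (hQ Y KY (scons x (fun=> 0))).
  by split=> -[w h]; exists w; apply/hB.
have F w : teval (scons x (scons w (fun=> 0))) \o s = scons w (scons x (fun=> 0)).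
  by apply/funext; case=> [|[|[|k]]].
by split=> -[w h]; exists w; move: h; rewrite sat_subst F.
Qed.

Section Diagonal.
Variables (Q : forcing) (A : set nat) (f : nat -> nat -> nat * bool) (cf : oracle_code).
Hypothesis hQ : notion_of_forcing Q.
Hypothesis cfE : forall p i, cond Q p ->
  eval A cf (npair p i) (npair (f p i).1 (f p i).2).
Hypothesis f_decides : forall p i, cond Q p -> ext Q (f p i).1 p /\
  if (f p i).2 then forces Q (f p i).1 (sigma1_enum i)
  else forces Q (f p i).1 (FNot (sigma1_enum i)).

(** A descending chain from [r] whose step [i] passes below the answer of [f] to sentence [i] at the
    current condition and lengthens the valuation to at least [i]. *)
Lemma generic_chain r : cond Q r -> exists F,
  [/\ generic_enough Q F, forall q, F q -> ext Q q r &
     forall i, exists p q, [/\ ext Q p r, F q & ext Q q (f p i).1]].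
Proof.
move=> Qr.
have /choice[g hg] : forall u : nat * nat, exists q, cond Q u.1 ->
    ext Q q (f u.1 u.2).1 /\ u.2 <= size (valuation Q q).
  move=> [p k] /=; have [Qp|nQp] := EM (cond Q p); last by exists 0 => /nQp.
  have [fp _] := f_decides k Qp; have [Qfp _] := ext_cond hQ fp.
  have [q qfp [_ kq]] := (val_dense hQ k).2 _ Qfp.
  by exists q.
pose t := nat_rec (fun=> nat) r (fun k p => g (p, k)).
have tQ k : cond Q (t k).
  by elim: k => //= k /(hg (_, k))[] /= /(ext_cond hQ)[].
have tS k : ext Q (t k.+1) (f (t k) k).1 by have [] := hg (t k, k) (tQ k).
have tSt k : ext Q (t k.+1) (t k).
  by apply: ext_trans (tS k) (f_decides k (tQ k)).1.
have tD j k : ext Q (t (k + j)) (t k).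
  elim: j => [|j IH]; first by rewrite addn0; exact: ext_refl.
  by rewrite addnS; exact: ext_trans (tSt _) IH.
have tle j k : j <= k -> ext Q (t k) (t j) by move=> /subnKC <-.
exists (range t); split.
- split.
  + by move=> _ [k _ <-].
  + move=> _ _ [j _ <-] [k _ <-]; exists (t (maxn j k)).
    by split; [exists (maxn j k) | apply: tle; exact: leq_maxl | apply: tle; exact: leq_maxr].
  + move=> n; exists (t n.+1); first by exists n.+1.
    by have [] := hg (t n, n) (tQ n).
- by move=> _ [k _ <-]; exact: (tle 0).
- move=> i; exists (t i), (t i.+1); split=> //; first exact: (tle 0).
Qed.

(** A positive answer is true by the truth lemma. After a negative one, an element of [F] forcing
    the sentence would share an extension with [q], below which the negation is forced. *)
Lemma decided_by_enough F p q i : generic_enough Q F -> cond Q p -> F q ->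
  ext Q q (f p i).1 ->
  sat (val_filter Q F) (fun=> 0) (sigma1_enum i) <-> (f p i).2.
Proof.
move=> gF Qp Fq qf.
have /andP[_ s1] := sigma1_enum_sentence i.
rewrite (truth _ hQ gF s1); have := (f_decides i Qp).2.
case: (f p i).2 => h; split=> //.
  by move=> _; exists q => //; exact: forces_mono h.
move=> [r Fr hr].
have [u [_ uq ur]] := enough_dir gF Fq Fr.
by case: (h u (ext_trans hQ uq qf)); exact: forces_mono hr.
Qed.

(** The bit [b] selects one of the two formulas. If they defined the values 0 and 1 of [A], the
    right answer at [x] would be whether [b] is A(x). *)
Lemma diagonalization e p0 : cond Q p0 -> exists p x (b : bool),
  ext Q p p0 /\ (f p (inst_code (if b then nsnd e else nfst e) x)).2 != (b == `[< A x >]).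
Proof.
move=> Qp0; apply: contrapT => no.
pose i (b : bool) x := inst_code (if b then nsnd e else nfst e) x.
have fA p x b : ext Q p p0 -> (f p (i b x)).2 = (b == `[< A x >]).
  by move=> pp0; apply/eqP/negPn/negP => h; apply: no; exists p, x, b.
(* The sets in which the two formulas define [A] correctly; over them [A] is uniformly Sigma^0_1. *)
pose K := [set Y | forall x b, sat Y (fun=> 0) (sigma1_enum (i b x)) <-> b = `[< A x >]].
have sA : sigma K (fun Y rho => rho 1 = `[< A (rho 0) >]).
  apply: sigma_ext (sigma_or
    (sigma_and (sigma_sentence K (nfst e)) (sigma_eq K (TVar 1) TZero))
    (sigma_and (sigma_sentence K (nsnd e)) (sigma_eq K (TVar 1) (TSucc TZero)))) _.
  move=> Y KY rho /=.
  rewrite -[inst_code (nfst e) _]/(i false _) -[inst_code (nsnd e) _]/(i true _) !KY.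
  by case: asboolP => _; split=> [->|[[]|[]]] //; [right | left].
(* The answers at the fixed condition [p0], along the diagonal. *)
have [c cE] : exists c, forall x, eval A c x (f p0 (inst_code x x)).2.
  have [d dE] := rec_pair (rec_const A p0) (rec_inst_code (rec_id A) (rec_id A)).
  exists (CComp CSnd (CComp cf d)) => x /=.
  exists (npair (f p0 (inst_code x x)).1 (f p0 (inst_code x x)).2); last by rewrite nsnd_pair.
  by exists (npair p0 (inst_code x x)) => //; exact: cfE.
(* In every [Y] of [K], the sentence [j] says that [f] answers 0 to [j] at [p0]. *)
have [x xE] := @sigma_index K (fun x => eval A c x 0)
  (@sigma2 K (eval A c) (sigma_eval sA c) (TVar 0) TZero).
set j := inst_code x x in xE.
have [Qr rspec] := f_decides j Qp0.
(* The chain starts below the answer to [j], which makes that answer correct. Being below [p0], it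
   also meets only answers that agree with [A], so its set lies in [K]. *)
have [F [gF Fle Fdec]] := generic_chain (ext_cond hQ Qr).1.
have KF : K (val_filter Q F).
  move=> y b; have [p [q [pr Fq qp]]] := Fdec (i b y).
  have pp0 := ext_trans hQ pr Qr.
  by rewrite (decided_by_enough gF (ext_cond hQ pp0).1 Fq qp) fA //; split=> /eqP.
have [q Fq _] := enough_val gF 0.
have := xE _ KF x; rewrite (decided_by_enough gF Qp0 Fq (Fle q Fq)) /= => h.
have := cE x; rewrite -/j in h *; case: (f p0 j).2 h => -[h0 h1] ev.
  by have := eval_inj (h1 isT) ev.
by have := h0 ev.
Qed.

End Diagonal.

(** * Binary strings *)

Definition bit (n i : nat) : bool := nth false (str_dec n) i.
Definition len (n : nat) : nat := size (str_dec n).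

(** This is 2^(n+1) - 1, the number of strings of length at most [n]. It turns quantifiers over
    strings of a given length into bounded ones. *)
Fixpoint code_bound (n : nat) : nat :=
  if n is m.+1 then (code_bound m + code_bound m).+1 else 1.

Lemma str_code_bound s : str_code s < code_bound (size s).
Proof. by elim: s => //= b s IH; rewrite -addnn; case: b; lia. Qed.

Lemma code_lt n : n < code_bound (len n).
Proof. by rewrite -{1}(str_decK n); exact: str_code_bound. Qed.

Lemma str_decS n : str_dec n.+1 = odd n :: str_dec n./2.
Proof.
apply: (can_inj str_codeK); rewrite str_decK /= str_decK.
by rewrite addnS addnC odd_double_half.
Qed.

(** Taking the tail acts on codes as m |-> (m - 1)/2 and fixes the code 0 of the empty string, so
    lengths and bits can be read by iteration. *)
Lemma drop_str_dec i n : drop i (str_dec n) = str_dec (iter i (fun m => m.-1./2) n).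
Proof.
elim: i n => [|i IH] n; first by rewrite drop0.
by rewrite iterSr -IH; case: n => [|n]; [case: i {IH} | rewrite str_decS].
Qed.

Section StringFunctions.
Variable A : set nat.

Lemma rec_half f : rec_fun A f -> rec_fun A (fun x => (f x)./2).
Proof.
move=> cf; apply: rec_ext (rec_natrec (rec_const A 0) cf (g := fun _ m z => m - z) _) _.
  exact: rec_sub (rec_fst (rec_snd (rec_id A))) (rec_snd (rec_snd (rec_id A))).
by move=> x; elim: (f x) => //= m ->; rewrite uphalf_half; have := odd_double_half m; lia.
Qed.

Lemma rec_tails f i : rec_fun A f -> rec_fun A i ->
  rec_fun A (fun x => iter (i x) (fun m => m.-1./2) (f x)).
Proof.
move=> cf ci; apply: rec_ext (rec_natrec cf ci (g := fun _ _ z => z.-1./2) _) _.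
  exact: rec_half (rec_predn (rec_snd (rec_snd (rec_id A)))).
by move=> x; elim: (i x) => //= m ->.
Qed.

Lemma lt_len i n : i < len n <-> 0 < iter i (fun m => m.-1./2) n.
Proof.
rewrite /len -subn_gt0 -size_drop drop_str_dec.
by case: (iter i _ n) => [|m]; rewrite ?str_decS.
Qed.

(** By [lt_len], comparison with the length is computable before the length itself is; a search then
    finds the length. *)
Lemma rec_len f : rec_fun A f -> rec_fun A (fun x => len (f x)).
Proof.
apply: (@rec_comp _ len).
have cI R S : rec_fun A R -> rec_fun A S -> rec_pred A (fun x => R x < len (S x)).
  move=> cR cS; apply: recp_ext (recp_lt (rec_const A 0) (rec_tails cS cR)) _ => x.
  exact: lt_len.
have [||g cg gE] := @rec_search A (fun x y => ~ y < len x /\ forall z, z < y -> z < len x).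
- apply: recp_and; first apply: recp_not.
    by apply: cI; [exact: rec_snd (rec_id A) | exact: rec_fst (rec_id A)].
  apply: recp_ball; first exact: rec_snd (rec_id A).
  by apply: cI; [exact: rec_snd (rec_id A) | exact: rec_fst (rec_fst (rec_id A))].
- by move=> x; exists (len x); rewrite ltnn.
apply: rec_ext cg _ => x; have [/negP h1 h2] := gE x.
apply/eqP; rewrite eqn_leq leqNgt andbC; apply/andP; split; first by rewrite leqNgt.
by apply/negP => /h2; rewrite ltnn.
Qed.

Lemma recp_bit f i : rec_fun A f -> rec_fun A i -> rec_pred A (fun x => bit (f x) (i x)).
Proof.
move=> cf ci; pose t x := iter (i x) (fun m => m.-1./2) (f x).
have ct : rec_fun A t by exact: rec_tails.
have cp := rec_predn ct.
(* The remaining string is nonempty and its head, the parity of the predecessor of its code, is odd;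
   past the end the default bit is false. *)
apply: recp_ext (recp_and (recp_lt (rec_const A 0) ct)
  (recp_lt (rec_const A 0) (rec_sub cp (rec_add (rec_half cp) (rec_half cp))))) _ => x.
rewrite /bit -[i x]addn0 -nth_drop drop_str_dec -/(t x).
case: (t x) => [|m]; first by split=> // -[].
by rewrite str_decS /=; have := odd_double_half m; lia.
Qed.

Lemma rec_code_bound f : rec_fun A f -> rec_fun A (fun x => code_bound (f x)).
Proof.
move=> cf; apply: rec_ext (rec_natrec (rec_const A 1) cf (g := fun _ _ z => (z + z).+1) _) _.
  by apply: rec_succ; apply: rec_add; exact: rec_snd (rec_snd (rec_id A)).
by move=> x; elim: (f x) => //= m ->.
Qed.

Lemma recp_iff R S : rec_pred A R -> rec_pred A S -> rec_pred A (fun x => R x <-> S x).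
Proof. by move=> cR cS; apply: recp_and; exact: recp_imp. Qed.

Lemma recp_and3 R S T : rec_pred A R -> rec_pred A S -> rec_pred A T ->
  rec_pred A (fun x => [/\ R x, S x & T x]).
Proof.
move=> cR cS cT; apply: recp_ext (recp_and cR (recp_and cS cT)) _.
by move=> x; split=> [[]|[? []]].
Qed.

Lemma recp_and4 R S T U : rec_pred A R -> rec_pred A S -> rec_pred A T ->
  rec_pred A U -> rec_pred A (fun x => [/\ R x, S x, T x & U x]).
Proof.
move=> cR cS cT cU; apply: recp_ext (recp_and cR (recp_and3 cS cT cU)) _.
by move=> x; split=> [[]|[? []]].
Qed.

Lemma recp_comp2 (E : nat -> nat -> Prop) f g :
  rec_pred A (fun n => E (nfst n) (nsnd n)) -> rec_fun A f -> rec_fun A g ->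
  rec_pred A (fun x => E (f x) (g x)).
Proof.
move=> cE cf cg; apply: recp_ext (recp_comp cE (rec_pair cf cg)) _ => x.
by rewrite nfst_pair nsnd_pair.
Qed.

Lemma recp_comp3 (E : nat -> nat -> nat -> Prop) f g k :
  rec_pred A (fun n => E (nfst n) (nfst (nsnd n)) (nsnd (nsnd n))) ->
  rec_fun A f -> rec_fun A g -> rec_fun A k ->
  rec_pred A (fun x => E (f x) (g x) (k x)).
Proof.
move=> cE cf cg ck; apply: recp_ext (recp_comp cE (rec_pair cf (rec_pair cg ck))) _ => x.
by rewrite !(nfst_pair, nsnd_pair).
Qed.

End StringFunctions.

(** * The stage construction *)

Ltac rec_tac := repeat (cbv beta; lazymatch goal with
  | |- rec_fun _ (fun x => x) => exact: rec_id
  | |- rec_fun _ (fun x => nfst (@?f x)) => apply: (@rec_fst _ f)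
  | |- rec_fun _ (fun x => nsnd (@?f x)) => apply: (@rec_snd _ f)
  | |- rec_fun _ (fun x => (@?f x).+1) => apply: (@rec_succ _ f)
  | |- rec_fun _ (fun x => npair (@?f x) (@?g x)) => apply: (@rec_pair _ f g)
  | |- rec_fun _ (fun x => len (@?f x)) => apply: (@rec_len _ f)
  | |- rec_fun _ (fun x => code_bound (@?f x)) => apply: (@rec_code_bound _ f)
  | |- rec_fun _ (fun x => inst_code (@?f x) (@?g x)) => apply: (@rec_inst_code _ f g)
  | |- rec_fun _ (fun _ => ?n) => exact: (rec_const _ n)
  | |- rec_fun _ (fun x => if _ then _ else _) => apply: rec_if
  | |- rec_pred _ (fun x => and (@?R x) (@?S x)) => apply: (@recp_and _ R S)
  | |- rec_pred _ (fun x => and3 (@?R x) (@?S x) (@?T x)) => apply: (@recp_and3 _ R S T)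
  | |- rec_pred _ (fun x => and4 (@?R x) (@?S x) (@?T x) (@?U x)) => apply: (@recp_and4 _ R S T U)
  | |- rec_pred _ (fun x => or (@?R x) (@?S x)) => apply: (@recp_or _ R S)
  | |- rec_pred _ (fun x => not (@?R x)) => apply: (@recp_not _ R)
  | |- rec_pred _ (fun x => iff (@?R x) (@?S x)) => apply: (@recp_iff _ R S)
  | |- rec_pred _ (fun x => is_true (leq (S (@?f x)) (@?g x))) => apply: (@recp_lt _ f g)
  | |- rec_pred _ (fun x => is_true (bit (@?f x) (@?g x))) => apply: (@recp_bit _ f g)
  | |- rec_pred _ (fun x => @eq nat (@?f x) (@?g x)) => apply: (@recp_eq _ f g)
  | h : rec_pred ?A (fun n => ?E (nfst n) (nsnd n))
      |- rec_pred ?A (fun x => ?E (@?f x) (@?g x)) => apply: (@recp_comp2 A E f g h)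
  | h : rec_pred ?A (fun n => ?E (nfst n) (nfst (nsnd n)) (nsnd (nsnd n)))
      |- rec_pred ?A (fun x => ?E (@?f x) (@?g x) (@?k x)) => apply: (@recp_comp3 A E f g k h)
  | |- rec_pred _ (fun x => ex2 _ _) => apply: recp_bex
  | |- rec_pred _ (fun x => @?R x -> @?S x) => apply: (@recp_imp _ R S)
  | |- rec_pred _ (fun x => forall z, _) => apply: recp_ball
  | h : rec_pred ?A ?R |- rec_pred ?A (fun x => ?R (@?f x)) => apply: (@recp_comp A R f h)
  | |- rec_fun _ nsnd => exact: rec_snd (rec_id _)
  | |- rec_fun _ len => exact: rec_len (rec_id _)
  | h : rec_fun ?A ?g |- rec_fun ?A ?g => exact: h
  | h : rec_fun ?A ?g |- rec_fun ?A (fun x => ?g (@?f x)) => apply: (@rec_comp A g f h)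
  end).

Section Construction.
Variables (A : set nat) (P : forcing).
Let Q := forcing_prod cohen P.
Variables (f : nat -> nat -> nat * bool) (cf : oracle_code).
Hypothesis hP : notion_of_forcing P.
Hypothesis cfE : forall p i, cond Q p ->
  eval A cf (npair p i) (npair (f p i).1 (f p i).2).
Hypothesis f_decides : forall p i, cond Q p -> ext Q (f p i).1 p /\
  if (f p i).2 then forces Q (f p i).1 (sigma1_enum i)
  else forces Q (f p i).1 (FNot (sigma1_enum i)).
Hypothesis cond_rec : rec_pred A (cond Q).
Hypothesis ext_rec : rec_pred A (fun n => ext Q (nfst n) (nsnd n)).

Let hQ : notion_of_forcing Q := cohen_prod_notion hP.

(* e codes a pair of codes of formulas and z codes a triple (p, x, b). *)
Definition query (e z : nat) : nat :=
  inst_code (if `[< 0 < nsnd (nsnd z) >] then nsnd e else nfst e) (nfst (nsnd z)).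

(** The last clause makes the answer differ from the truth value of b = A(x). As [c] occurs only as
    an extension of the answer, further extensions of [c] keep the property. *)
Definition beats (e c z : nat) : Prop :=
  [/\ cond Q (nfst z), ext Q c (f (nfst z) (query e z)).1
    & ~ ((f (nfst z) (query e z)).2 <-> (0 < nsnd (nsnd z) <-> A (nfst (nsnd z))))].

(* s codes (e, c) and v codes (g', q, w), where w bounds the witnesses, which
   makes the relation A-computable. *)
Definition good_step (g s v : nat) : Prop :=
  let g' := nfst v in let q := nfst (nsnd v) in let w := nsnd (nsnd v) in
  let e := nfst s in let c := nsnd s in
  [/\ len g < len g', forall i, i < len g -> (bit g' i <-> bit g i)
    & cond Q c -> [/\ s < q, cond Q (npair g' q),
        exists2 z, z < w & ext Q z c /\ nsnd z = q
      & forall a, a < code_bound (len g') -> len a = len g' ->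
          (forall i, i < len g' -> len g < i -> (bit a i <-> bit g' i)) ->
          exists2 z, z < w & beats e (npair a q) z]].

Lemma good_step_rec : rec_pred A (fun u => good_step (nfst (nfst u)) (nsnd (nfst u)) (nsnd u)).
Proof.
(* [f] is computable on conditions only, so it is replaced by a total function with value 0
   elsewhere. *)
pose fhat u := if `[< cond Q (nfst u) >] then
  npair (f (nfst u) (nsnd u)).1 (f (nfst u) (nsnd u)).2 else 0.
have fhat_rec : rec_fun A fhat.
  apply: (@rec_guard _ (fun u => cond Q (nfst u)) cf); first by rec_tac.
  by move=> u /(cfE (nsnd u)); rewrite npairK.
pose beats' e c z := [/\ cond Q (nfst z),
    ext Q c (nfst (fhat (npair (nfst z) (query e z))))
  & ~ (0 < nsnd (fhat (npair (nfst z) (query e z))) <->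
       (0 < nsnd (nsnd z) <-> A (nfst (nsnd z))))].
have beats'E e c z : beats e c z <-> beats' e c z.
  have E : cond Q (nfst z) -> fhat (npair (nfst z) (query e z)) =
      npair (f (nfst z) (query e z)).1 (f (nfst z) (query e z)).2.
    by rewrite /fhat nfst_pair nsnd_pair; case: asboolP.
  rewrite /beats /beats'.
  have [cz|ncz] := EM (cond Q (nfst z)); last by split=> -[].
  by rewrite E // nfst_pair nsnd_pair; case: (f _ _).2.
have A_rec : rec_pred A A by exists COracle.
have beats_rec : rec_pred A (fun u => beats (nfst u) (nfst (nsnd u)) (nsnd (nsnd u))).
  apply: recp_ext (_ : rec_pred A (fun u => beats' (nfst u) (nfst (nsnd u)) (nsnd (nsnd u)))) _.
    by rewrite /beats' /query; rec_tac.
  by move=> u; exact: beats'E.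
by rewrite /good_step; cbv zeta; rec_tac.
Qed.

Lemma ext_val p q : ext P q p -> size (valuation P p) <= size (valuation P q).
Proof. by move/(val_mono hP)/size_prefix. Qed.

(** Only finitely many numbers are at most [s], so a condition with a long enough valuation is
    larger than [s]. *)
Lemma large_extension p n s : cond P p ->
  exists q, [/\ ext P q p, n <= size (valuation P q) & s < q].
Proof.
move=> Pp; have [||m hm] := @uniform_bound (fun q m => size (valuation P q) < m) s.+1.
- by move=> q m m' mm' h; exact: leq_trans mm'.
- by move=> q; exists (size (valuation P q)).+1.
have [q qp [_]] := (val_dense hP (maxn n m)).2 _ Pp.
rewrite geq_max => /andP[nq mq]; exists q; split=> //.
by rewrite ltnNge; apply/negP => qs; have := hm q qs; rewrite ltnNge mq.
Qed.

Lemma product_extension s p q : ext P q p -> size s = size (valuation P p) ->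
  forall t, size (s ++ t) = size (valuation P q) ->
  ext Q (npair (str_code (s ++ t)) q) (npair (str_code s) p).
Proof.
move=> qp sp t tq; have [Pq Pp] := ext_cond hP qp.
by rewrite /Q /= !(nfst_pair, nsnd_pair) !str_codeK; split=> //; exact: prefix_prefix.
Qed.

(** The strings of [L] are treated in turn. Diagonalization above [a ++ t] lengthens the string by
    some [u], which is added to the tail shared by all strings; the final step makes [q] exceed
    [s]. *)
Lemma beats_all e m s (L : seq (seq bool)) : all (fun a => size a == m) L ->
  forall p t, cond P p -> m + size t = size (valuation P p) ->
  exists q t', [/\ ext P q p, s < q, m + size (t ++ t') = size (valuation P q) &
    forall a, a \in L -> exists z, beats e (npair (str_code (a ++ t ++ t')) q) z].
Proof.
elim: L => [|a L IH] /= Lm p t Pp tp.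
  have [q [qp _ sq]] := large_extension 0 s Pp.
  exists q, (nseq (size (valuation P q) - size (valuation P p)) false); split=> //.
  by rewrite size_cat size_nseq addnA tp subnKC // ext_val.
have {Lm} /andP[/eqP am Lm] := Lm; pose c := npair (str_code (a ++ t)) p.
have Qc : cond Q c.
  by rewrite /Q /= !(nfst_pair, nsnd_pair) str_codeK size_cat am.
have [p' [x [b [p'c neq]]]] := diagonalization hQ cfE f_decides e Qc.
have [Qp' _] := ext_cond hQ p'c.
pose i := inst_code (if b then nsnd e else nfst e) x.
set r := (f p' i).1; have rp' : ext Q r p' := (f_decides i Qp').1.
have [[_ Pr rE] _ rc1 rc2] := ext_trans hQ rp' p'c.
move: rc1 rc2; rewrite /c nfst_pair nsnd_pair /= str_codeK => /prefixP[u ru] rp.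
have [|q [t' [qr sq tq hL]]] := IH Lm (nsnd r) (t ++ u) Pr.
  by rewrite -rE /= ru !size_cat am addnA.
have qp := ext_trans hP qr rp; exists q, (u ++ t'); split=> //.
  by rewrite catA.
move=> a'; rewrite inE => /predU1P[->|/hL]; last by rewrite -catA.
exists (npair p' (npair x b)).
have iE : query e (npair p' (npair x b)) = i.
  by rewrite /query !(nfst_pair, nsnd_pair) asboolb /i; case: (b).
rewrite /beats iE !(nfst_pair, nsnd_pair) -/r; split=> //.
  (* The later strings only extend the tail and [q], so the final condition for [a] still extends
     the answer [r]. *)
  have -> : a ++ t ++ u ++ t' = (a ++ t ++ u) ++ t' by rewrite -!catA.
  rewrite -(npairK r) -[nfst r]str_decK ru -[(a ++ t) ++ u]catA.
  apply: product_extension => //; first by rewrite -rE /= ru catA.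
  by rewrite -!catA size_cat am -tq !catA.
move=> h; move/negP: neq; apply; apply/eqP; apply/idP/eqP.
  by move=> /h; case: (b) => h'; apply/esym; [apply: asboolT; apply/h' | apply: asboolF => /h'].
by move=> bE; apply/h; rewrite bE; case: asboolP.
Qed.

Lemma good_step_exists g s : exists v, good_step g s v.
Proof.
pose e := nfst s; pose c := nsnd s.
have [Qc|nQc] := EM (cond Q c); last first.
  (* If [c] is not a condition, the stage adds a free position and an empty block. *)
  exists (npair (str_code (str_dec g ++ [:: false])) 0).
  rewrite /good_step !nfst_pair /len /bit str_codeK; split=> //.
    by rewrite size_cat addn1.
  by move=> i ig; rewrite nth_cat ig.
pose n := (len g).+1.
have [Pc cE] : cond P (nsnd c) /\ size (str_dec (nfst c)) = size (valuation P (nsnd c)).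
  by case: Qc.
have [p [pc np _]] := large_extension n 0 Pc; have [Pp _] := ext_cond hP pc.
pose t := nseq (size (valuation P p) - n) false.
(* All strings of length [n] are treated, where [n] includes the new free position; only the block
   after it is shared. *)
have [||q [t' [qp sq tq hL]]] := @beats_all e n s
    [seq val a | a : n.-tuple bool] _ p t Pp.
- by apply/allP => _ /mapP[a _ ->]; rewrite size_tuple.
- by rewrite size_nseq subnKC.
set tt := t ++ t' in tq hL; pose g' := str_code (str_dec g ++ false :: tt).
have lg' : len g' = n + size tt by rewrite /len str_codeK size_cat /= addnS -addSn.
have [||w hw] := @uniform_bound (fun a w => len a = len g' ->
    (forall i, i < len g' -> len g < i -> (bit a i <-> bit g' i)) ->
    exists2 z, z < w & beats e (npair a q) z) (code_bound (len g')).
- by move=> a m m' mm' h h1 h2; have [z zm bz] := h h1 h2; exists z => //; exact: leq_trans mm'.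
- move=> a.
  have [la|] := EM (len a = len g'); last by exists 0.
  have [ha|] := EM (forall i, i < len g' -> len g < i -> (bit a i <-> bit g' i)); last by exists 0.
  have sz : size (take n (str_dec a)) == n.
    by rewrite size_takel // -/(len a) la lg' leq_addr.
  have [|z bz] := hL (take n (str_dec a)).
    by apply/mapP; exists (Tuple sz); rewrite ?mem_enum.
  exists z.+1 => _ _; exists z => //; move: bz.
  suff -> : take n (str_dec a) ++ tt = str_dec a by rewrite str_decK.
  rewrite -[RHS](cat_take_drop n); congr cat; apply: (@eq_from_nth _ false).
    by rewrite size_drop -/(len a) la lg' addKn.
  move=> i itt; rewrite nth_drop -/(bit a (n + i)).
  have nig' : n + i < len g' by rewrite lg' ltn_add2l.
  have -> : nth false tt i = bit g' (n + i).
    rewrite /bit str_codeK nth_cat -/(len g) ltnNge ltnW ?leq_addr //=.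
    by rewrite /n addSn subSn ?leq_addr // addKn.
  by apply/idP/idP => /(ha _ nig' (leq_addr _ _)).
(* A product condition below [c], padded with zeros, witnesses that [q] extends the P-part of
   [c]. *)
have [zc zcE] : exists z, ext Q z c /\ nsnd z = q.
  pose u := nseq (size (valuation P q) - size (valuation P (nsnd c))) false.
  exists (npair (str_code (str_dec (nfst c) ++ u)) q); rewrite nsnd_pair; split=> //.
  have qc := ext_trans hP qp pc.
  rewrite -{2}(npairK c) -{2}[nfst c]str_decK; apply: product_extension => //.
  by rewrite size_cat size_nseq cE subnKC // ext_val.
exists (npair g' (npair q (maxn w zc.+1))).
rewrite /good_step !(nfst_pair, nsnd_pair); split; first by rewrite lg' leq_addr.
  by move=> i ig; rewrite /bit str_codeK nth_cat ig.
move=> _; split=> //.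
- rewrite /Q /= !(nfst_pair, nsnd_pair) str_codeK -/(len g'); split=> //.
    by have [] := ext_cond hP qp.
  by rewrite -tq -lg' /len str_codeK.
- by exists zc => //; exact: leq_maxr.
- move=> a ag' la ha; have [z zw bz] := hw a ag' la ha; exists z => //.
  by apply: leq_trans zw _; exact: leq_maxl.
Qed.

End Construction.

(** * The tree and the dense sets *)

Lemma onth_interleave s t n : size s = size t ->
  onth (interleave s t) n = if odd n then onth t n./2 else onth s n./2.
Proof.
elim: s t n => [|a s IH] [|b t] // n; first by rewrite /= !onth0n; case: odd.
case=> st; case: n => [|[|n]] //=.
by rewrite IH // negbK.
Qed.

Lemma onth_mkseq (g : nat -> bool) m n :
  onth (mkseq g m) n = if n < m then Some (g n) else None.
Proof.
case: ltnP => nm; last by rewrite onth_default // size_mkseq.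
by rewrite onthE (nth_map false) ?size_mkseq // nth_mkseq.
Qed.

Definition initial (S : set nat) (n : nat) : seq bool := mkseq (fun i => `[< S i >]) n.

Lemma size_initial S n : size (initial S n) = n.
Proof. exact: size_mkseq. Qed.

Lemma prefix_initial S m n : m <= n -> prefix (initial S m) (initial S n).
Proof.
move=> mn; rewrite prefixE size_initial; apply/eqP/(@eq_from_nth _ false).
  by rewrite size_takel !size_initial.
rewrite size_takel ?size_initial // => i im.
by rewrite nth_take // !nth_mkseq // (leq_trans im).
Qed.

Section Product.
Variable P : forcing.
Hypothesis hP : notion_of_forcing P.

Definition product_filter (S F : set nat) : set nat :=
  [set c | exists2 p, F p & c = npair (str_code (initial S (size (valuation P p)))) p].

Lemma product_filter_enough S F : is_filter P F -> val_infinite P F ->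
  generic_enough (forcing_prod cohen P) (product_filter S F).
Proof.
move=> [Fc _ _ dF] vF; pose lift p := npair (str_code (initial S (size (valuation P p)))) p.
have cl p : F p -> cond (forcing_prod cohen P) (lift p).
  by move=> Fp; rewrite /lift /= !(nfst_pair, nsnd_pair) str_codeK size_initial;
    split=> //; exact: Fc.
have el p q : F p -> F q -> ext P q p -> ext (forcing_prod cohen P) (lift q) (lift p).
  move=> Fp Fq qp; split; [exact: cl | exact: cl | |].
    rewrite /lift /= !nfst_pair !str_codeK prefix_initial //.
    by have /size_prefix := val_mono hP qp.
  by rewrite /lift !nsnd_pair.
split.
- by move=> _ [p Fp ->]; exact: cl.
- move=> _ _ [p Fp ->] [q Fq ->]; have [r [Fr rp rq]] := dF p q Fp Fq.
  by exists (lift r); split; [exists r | exact: el | exact: el].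
- move=> n; have [p Fp np] := vF n; exists (lift p); first by exists p.
  rewrite /lift /= !(nfst_pair, nsnd_pair) str_codeK size_interleave ?size_initial //.
  by rewrite -addnn; lia.
Qed.

Lemma val_product_filter S F : val_infinite P F ->
  val_filter (forcing_prod cohen P) (product_filter S F) =
  set_join S (val_filter P F).
Proof.
move=> vF; apply/seteqP; split=> n.
  move=> [_ [p Fp ->]] /=; rewrite !(nfst_pair, nsnd_pair) str_codeK.
  rewrite onth_interleave ?size_initial // /set_join /=; case: odd; first by exists p.
  by rewrite onth_mkseq; case: ifP => // _ [/asboolP].
have E p : valuation (forcing_prod cohen P)
    (npair (str_code (initial S (size (valuation P p)))) p) =
    interleave (initial S (size (valuation P p))) (valuation P p).
  by rewrite /= !(nfst_pair, nsnd_pair) str_codeK.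
rewrite /set_join /=; case: ifP => on.
  move=> [p Fp pn]; exists (npair (str_code (initial S (size (valuation P p)))) p).
    by exists p.
  by rewrite E onth_interleave ?size_initial // on.
move=> Sn; have [p Fp np] := vF n./2.+1.
exists (npair (str_code (initial S (size (valuation P p)))) p); first by exists p.
by rewrite E onth_interleave ?size_initial // on onth_mkseq np asboolT.
Qed.

End Product.

(** Over the single set [X], the oracle is given by an atomic formula; [sigma_eval] then turns a
    reduction to [X] into formulas about [X]. *)
Lemma oracle_sigma X : sigma [set X] (fun Y rho => rho 1 = `[< X (rho 0) >]).
Proof.
have dIn : delta0 [set X] (fun Y rho => Y (rho 0)) := delta0_sat _ (isT : bounded (FIn (TVar 0))).
apply: sigma_ext (sigma_or
  (sigma_and (delta0_sigma dIn) (sigma_eq _ (TVar 1) (TSucc TZero)))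
  (sigma_and (delta0_sigma (delta0_not dIn)) (sigma_eq _ (TVar 1) TZero))) _.
move=> Y -> rho /=; case: asboolP => Xx; split.
- by move=> ->; left.
- by move=> [[]|[]].
- by move=> ->; right.
- by move=> [[]|[]].
Qed.

Section Tree.
Variables (A : set nat) (P : forcing).
Let Q := forcing_prod cohen P.
Variables (f : nat -> nat -> nat * bool) (cf : oracle_code).
Hypothesis hP : notion_of_forcing P.
Hypothesis cfE : forall p i, cond Q p ->
  eval A cf (npair p i) (npair (f p i).1 (f p i).2).
Hypothesis f_decides : forall p i, cond Q p -> ext Q (f p i).1 p /\
  if (f p i).2 then forces Q (f p i).1 (sigma1_enum i)
  else forces Q (f p i).1 (FNot (sigma1_enum i)).
Hypothesis cond_rec : rec_pred A (cond Q).
Hypothesis ext_rec : rec_pred A (fun n => ext Q (nfst n) (nsnd n)).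

Lemma stages : exists g q : nat -> nat, [/\ rec_fun A g, rec_fun A q &
  forall s, exists w, good_step A P f (g s) s (npair (g s.+1) (npair (q s) w))].
Proof.
have [x|nx nx_rec nxE] := @rec_search A (fun x => good_step A P f (nfst x) (nsnd x))
    (good_step_rec cfE cond_rec ext_rec).
  exact: good_step_exists hP cfE f_decides _ _.
(* State [s.+1] codes the triple of [g s.+1], [q s] and a witness bound. The initial state 0 has
   first component 0, the code of the empty string. *)
pose st := nat_rec (fun=> nat) 0 (fun s v => nx (npair (nfst v) s)).
have st_rec : rec_fun A st.
  apply: (rec_natrec (rec_const A 0) (rec_id A) (g := fun _ s v => nx (npair (nfst v) s))).
  by rec_tac.
exists (fun s => nfst (st s)), (fun s => nfst (nsnd (st s.+1))); split.
- by rec_tac.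
- by rec_tac.
- move=> s; exists (nsnd (nsnd (st s.+1))); rewrite !npairK.
  by have := nxE (npair (nfst (st s)) s); rewrite nfst_pair nsnd_pair.
Qed.


Variables g q : nat -> nat.
Hypothesis g_rec : rec_fun A g.
Hypothesis q_rec : rec_fun A q.
Hypothesis gq_step : forall s,
  exists w, good_step A P f (g s) s (npair (g s.+1) (npair (q s) w)).

Lemma len_stageS s : len (g s) < len (g s.+1).
Proof. by have [w []] := gq_step s; rewrite nfst_pair. Qed.

Lemma len_stage s : s <= len (g s).
Proof. by elim: s => // s IH; exact: leq_ltn_trans IH (len_stageS s). Qed.

Lemma len_stage_mono s t : s <= t -> len (g s) <= len (g t).
Proof.
move=> /subnKC <-; elim: (t - s) => [|d IH]; rewrite ?addn0 // addnS.
by rewrite (leq_trans IH) // ltnW // len_stageS.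
Qed.

Lemma bit_stage_mono s t i : s <= t -> i < len (g s) -> bit (g t) i = bit (g s) i.
Proof.
move=> /subnKC <- il; elim: (t - s) => [|d IH]; rewrite ?addn0 // addnS -IH.
have [w [_ h _]] := gq_step (s + d); move: h; rewrite nfst_pair => h.
by apply/idP/idP => /h; apply; rewrite (leq_trans il) // len_stage_mono // leq_addr.
Qed.

Lemma bit_stage s t i : i < len (g s) -> i < len (g t) -> bit (g s) i = bit (g t) i.
Proof.
move=> si ti; case: (leqP s t) => [st|/ltnW ts]; first by rewrite (bit_stage_mono st).
exact: bit_stage_mono.
Qed.

(** Since [k <= len (g k)], the free positions can be recognized with [k] at most [i], and [g i.+1]
    is long enough to have a bit [i]. Both bounds serve computability. *)
Definition stage_tree : set (seq bool) := [set s | forall i, i < size s ->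
  (exists2 k, k < i.+1 & len (g k) = i) \/ nth false s i = bit (g i.+1) i].

Lemma stage_tree_perfect : perfect_tree stage_tree.
Proof.
split=> [//|s _ /prefixP[t ->] Tst i si|s Ts].
  by have := Tst i; rewrite size_cat nth_cat si; apply; exact: leq_trans (leq_addr _ _).
(* A free position not before the end of [s]: the two extensions follow the limit string up to it
   and differ there. *)
pose k := len (g (size s)).
have sk : size s <= k by exact: len_stage.
pose t b := mkseq (fun i => if i < size s then nth false s i else
  if i == k then b else bit (g i.+1) i) k.+1.
have Tt b : stage_tree (t b).
  move=> i; rewrite size_mkseq => ik; rewrite nth_mkseq //; case: ifP => [/Ts//|_].
  by case: eqP => [->|_]; [left; exists (size s) | right].
have st b : prefix s (t b).
  rewrite prefixE; apply/eqP/(@eq_from_nth _ false).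
    by rewrite size_takel // size_mkseq ltnW.
  rewrite size_takel ?size_mkseq; last exact: ltnW.
  by move=> i si; rewrite nth_take // nth_mkseq ?si // ltnW // ltnS (leq_trans si).
have nt b b' : prefix (t b) (t b') -> b = b'.
  rewrite prefixE size_mkseq take_oversize ?size_mkseq // => /eqP/(congr1 (nth false ^~ k)).
  by rewrite !nth_mkseq // ltnNge sk /= eqxx.
exists (t true), (t false); split=> //.
by apply/andP; split; apply/negP => /nt.
Qed.

Lemma stage_tree_computable : computable_tree A stage_tree.
Proof.
suff [c hc] : rec_pred A (fun n => stage_tree (str_dec n)) by exists c.
apply: (@recp_ext _ (fun n => forall i, i < len n ->
    (exists2 k, k < i.+1 & len (g k) = i) \/ (bit n i <-> bit (g i.+1) i))).
  by rec_tac.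
move=> n; split=> h i il; have [|e] := h i il; [by left | right | by left | right].
  by rewrite /bit -/(bit (g i.+1) i) -e.
by apply/idP/idP; rewrite -/(bit n i) => /e.
Qed.

Definition stage_class (e : nat) : set nat :=
  [set r | exists2 s, s < r & [/\ nfst s = e, cond Q (nsnd s) & r = q s]].

Lemma stage_class_computable : computable_class A stage_class.
Proof.
suff [c hc] : rec_pred A (fun n => stage_class (nfst n) (nsnd n)) by exists c.
by rewrite /stage_class /mkset; rec_tac.
Qed.

Lemma stage_class_dense e : dense_in P (stage_class e).
Proof.
split=> [_ [s _ [_ Qs ->]]|p Pp].
  have [w [_ _ /(_ Qs)[_]]] := gq_step s.
  by rewrite !(nfst_pair, nsnd_pair) => -[]; rewrite !nsnd_pair.
(* Any string of the right length would do as Cohen part; the valuation of [p] is at hand. *)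
pose c := npair (str_code (valuation P p)) p; pose s := npair e c.
have Qc : cond Q (nsnd s).
  by rewrite /s nsnd_pair /Q /c /= !(nfst_pair, nsnd_pair) str_codeK.
have [w [_ _ /(_ Qc)]] := gq_step s; rewrite !(nfst_pair, nsnd_pair).
move=> [sq _ [z _ [zc zq]] _]; exists (q s); last first.
  by exists s => //; split=> //; rewrite nfst_pair.
by have [_ _ _] := zc; rewrite zq /c nsnd_pair.
Qed.

(** A reduction to [X] yields formulas defining [A] in [X], with some index [e]. By density, the
    filter meets the class of [e] in some [q s], and with the initial segment of [S] of the same
    length this condition beats [e]. *)
Lemma stage_avoidance S G : paths stage_tree S -> generic P (range stage_class) G ->
  ~ turing_le A (set_join S G).
Proof.
move=> TS [F [Ffil Fval Fgen] ->]; set X := set_join _ _ => -[c cE].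
have sE := @sigma2 _ (eval X c) (sigma_eval (@oracle_sigma X) c) (TVar 0).
have [e0 e0E] := @sigma_index _ (fun x => eval X c x 0) (sE TZero).
have [e1 e1E] := @sigma_index _ (fun x => eval X c x 1) (sE (TSucc TZero)).
pose e := npair e0 e1.
have [p [Fp [s _ [se Qs pq]]]] : F `&` stage_class e !=set0.
  have Ce : range stage_class (stage_class e) by exists e.
  have [//|[p Fp no]] := Fgen _ Ce.
  have [r rp Dr] := (stage_class_dense e).2 p (filter_cond Ffil Fp).
  by case: (no r rp).
have [w [lg hg /(_ Qs)]] := gq_step s.
rewrite !(nfst_pair, nsnd_pair) -pq se => -[_ [_ _ sz] _ hw].
move: sz; rewrite !(nfst_pair, nsnd_pair) /= -/(len (g s.+1)) => sz.
pose a := str_code (initial S (size (valuation P p))).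
have la : len a = len (g s.+1) by rewrite [LHS]/len str_codeK size_initial sz.
have [||z _ [Qz az ne]] := hw a _ la.
- by rewrite -la; exact: code_lt.
- move=> i ig gi; have := TS (size (valuation P p)) i.
  rewrite size_mkseq -{1}sz => /(_ ig)[[k _ ki]|].
    (* No free position lies strictly between [len (g s)] and [len (g s.+1)], so [S] follows the
       limit string on the block. *)
    case: (leqP k s) => [/len_stage_mono|/len_stage_mono].
      by rewrite ki leqNgt gi.
    by rewrite ki leqNgt ig.
  rewrite [bit a i]/bit /a str_codeK => ->.
  by rewrite -/(bit (g i.+1) i) (@bit_stage i.+1 s.+1) // len_stage.
have hQ := cohen_prod_notion hP.
have gF := product_filter_enough hP S Ffil Fval.
have Fa : product_filter P S F (npair a p) by exists p.
have := decided_by_enough hQ f_decides gF Qz Fa az.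
(* The answer is true in [X], where the two formulas do define [A], against the last clause of
   [beats]. *)
rewrite val_product_filter // -/X => dec; apply: ne; rewrite -dec /query.
set x := nfst (nsnd z).
have ev b : eval X c x b <-> b = `[< A x >].
  by split=> [xb|->]; [exact: eval_inj xb (cE x I) | exact: cE].
rewrite asboolb; case: ltnP => _; rewrite ?nsnd_pair ?nfst_pair.
  by rewrite -e1E // ev; case: asboolP => Ax; split=> // -[h1 h2]; case: Ax; apply: h1.
by rewrite -e0E // ev; case: asboolP => Ax; split=> // -[h1 h2]; have := h2 Ax.
Qed.

End Tree.

Theorem theorem3p7 (A : set nat) (P : forcing) (hP : notion_of_forcing P)
    (hdec : one_decidable A (forcing_prod cohen P)) :
  exists (T : set (seq bool)) (D : nat -> set nat),
    [/\ perfect_tree T, computable_tree A T,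
        (forall e, dense_in P (D e)), computable_class A D &
        forall S G : set nat, paths T S -> generic P (range D) G ->
          ~ turing_le A (set_join S G)].
Proof.
have [[[cc ccE] [ce ceE] _] [f [[cf cfE] f_decides]]] := hdec.
have cond_rec : rec_pred A (cond (forcing_prod cohen P)) by exists cc => x; exact: ccE.
have ext_rec : rec_pred A (fun n => ext (forcing_prod cohen P) (nfst n) (nsnd n)).
  by exists ce => x; exact: ceE.
have [g [q [g_rec q_rec gq]]] := stages hP cfE f_decides cond_rec ext_rec.
exists (stage_tree g), (stage_class P q); split.
- exact: stage_tree_perfect gq.
- exact: stage_tree_computable.
- exact: stage_class_dense gq.
- exact: stage_class_computable.
- exact: stage_avoidance gq.
Qed.
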